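(* Let $a_{ac}\in[0,1]$ be the weight of the absolutely continuous part in the Lebesgue decomposition of the law of the pinning point $Z$. If $a_{ac}\neq 0$, then there exist non-constant random times $\tau$ such that the Lévy bridge $\zeta$ with length $\tau$ and pinning point $Z$, derived from the Lévy process $X$, does not possess the Markov property with respect to its natural filtration.
   Context: Everything is defined on a complete probability space $(\Omega,\mathcal{F},\mathbb{P})$; $\mathbb{P}_\theta$ denotes the law of a random variable $\theta$ under $\mathbb{P}$. Let $X=(X_t,t\ge0)$ be a one-dimensional Lévy process (realized as the coordinate process on the Skorohod space of càdlàg functions). Standing assumption: for every $t>0$ the law of $X_t$ is absolutely continuous with respect to Lebesgue measure, with density $f^X_t$. Deterministic bridges: for $r>0$ and $z\in\mathbb{R}$ with $0<f^X_r(z)<+\infty$, $\mathbb{P}^{r,z}$ denotes the unique probability measure such that $\mathbb{P}^{r,z}|_{\mathcal{F}^X_t}=\frac{f^X_{r-t}(z-X_t)}{f^X_r(z)}\,\mathbb{P}|_{\mathcal{F}^X_t}$ for all $t<r$, where $\mathcal{F}^X_t=\sigma(X_s,s\le t)$; it is the law of the bridge from $0$ to $z$ of length $r$ associated with $X$. $X^{r,z}=(X^{r,z}_t)_{0\le t\le r}$ denotes a càdlàg process with this law; it satisfies $\mathbb{P}(X^{r,z}_0=0,X^{r,z}_r=z)=1$, and for $0=t_0<t_1<\dots<t_n<r$ and $x_0=0$, $$\mathbb{P}(X^{r,z}_{t_1}\in \mathrm{d}x_1,\ldots,X^{r,z}_{t_n}\in \mathrm{d}x_n)=\frac{f^X_{r-t_n}(z-x_n)}{f^X_r(z)}\prod_{i=1}^n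 f^X_{t_i-t_{i-1}}(x_i-x_{i-1})\,\mathrm{d}x_1\ldots \mathrm{d}x_n.$$ The process $X^{r,z}$ is extended to $[0,\infty)$ by setting $X^{r,z}_t=z$ for $t\ge r$. Random bridges: for independent random variables $\tau$ and $Z$ with values in $(0,+\infty)$ and $\mathbb{R}$ respectively, a process $\zeta=(\zeta_t,t\ge0)$ is the Lévy bridge with random length $\tau$ and pinning point $Z$ derived from $X$ if: (i) $0<f^X_r(z)<\infty$ for $\mathbb{P}_{(\tau,Z)}$-almost every $(r,z)$; (ii) the conditional distribution of $\zeta$ given $\{\tau=r,Z=z\}$ is the law of the (extended) process $X^{r,z}$. Lebesgue decomposition: the law of $Z$ is written $\mathbb{P}_Z=(1-a_{ac})\mathbb{P}^{s}_Z+a_{ac}\mathbb{P}^{ac}_Z$ with $a_{ac}\in[0,1]$, where $\mathbb{P}^{ac}_Z$ is a probability measure absolutely continuous with respect to Lebesgue measure and $\mathbb{P}^s_Z$ is a probability measure singular with respect to Lebesgue measure. The Markov property of $\zeta$ with respect to its natural filtration $\mathcal{F}^\zeta_t=\sigma(\zeta_s,s\le t)$ means: for all $0\le t<u$ and all bounded measurable $g:\mathbb{R}\to\mathbb{R}$, $\mathbb{E}[g(\zeta_u)\mid\mathcal{F}^\zeta_t]=\mathbb{E}[g(\zeta_u)\mid\zeta_t]$, $\mathbb{P}$-a.s.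
   Formalization: It is also assumed that Z admits some non-constant length law satisfying condition (i) (otherwise false: X a gamma subordinator, Z<0), and τ and ζ live on an extension of the given probability space, which may be too small to carry a non-constant τ independent of Z. *)

(* Defs.v *)
From HB Require Import structures.
From mathcomp Require Import all_boot all_order all_algebra.
From mathcomp Require Import all_classical all_reals all_analysis.
From mathcomp Require Import measurable_realfun.

Set Implicit Arguments.
Unset Strict Implicit.
Unset Printing Implicit Defensive.

Import Order.TTheory GRing.Theory Num.Theory.
Import numFieldNormedType.Exports.

Local Open Scope classical_set_scope.
Local Open Scope ring_scope.

(** * Skorohod space *)

(* A path indexed by [0, +oo) is encoded as a function on R; the first clause
   makes the encoding injective. *)
Definition is_cadlag (R : realType) (w : R -> R) : Prop :=
  [/\ forall t, t < 0 -> w t = w 0,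
      forall t, 0 <= t -> w x @[x --> t^'+] --> w t
    & forall t, 0 < t -> cvg (w x @[x --> t^'-])].

Record skorohod (R : realType) := Skorohod {
  path_fun :> R -> R ;
  path_cadlag : is_cadlag path_fun }.

Lemma is_cadlag0 (R : realType) : is_cadlag (fun=> 0 : R).
Proof.
split=> // t _; first exact: cvg_cst.
by apply/cvg_ex; exists 0; exact: cvg_cst.
Qed.

HB.instance Definition _ (R : realType) := gen_eqMixin (skorohod R).
HB.instance Definition _ (R : realType) := gen_choiceMixin (skorohod R).
HB.instance Definition _ (R : realType) :=
  isPointed.Build (skorohod R) (Skorohod (is_cadlag0 R)).

Definition coord (R : realType) (t : R) (w : skorohod R) : R := w t.

Definition cylinders (R : realType) : set (set (skorohod R)) :=
  \bigcup_(t in [set t : R | 0 <= t]) g_sigma_algebra_preimage (coord t).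

HB.instance Definition _ (R : realType) :=
  Measurable.copy (skorohod R) (g_sigma_algebraType (@cylinders R)).

(** * Filtrations, conditional expectations, Markov property *)

Definition natural_filtration (R : realType) (T : pointedType)
    (Y : R -> T -> R) (t : R) : set (set T) :=
  <<s \bigcup_(s in [set s : R | 0 <= s <= t]) g_sigma_algebra_preimage (Y s) >>.

(* W is a version of E[Y | G], for a sub-sigma-algebra G *)
Definition is_cond_exp d (T : measurableType d) (R : realType)
    (P : probability T R) (G : set (set T)) (Y W : T -> R) : Prop :=
  [/\ forall B : set R, measurable B -> G (W @^-1` B),
      P.-integrable [set: T] (EFin \o W)
    & forall A, G A ->
        (\int[P]_(x in A) (W x)%:E = \int[P]_(x in A) (Y x)%:E)%E].

(* A conditional expectation of a bounded variable exists and is a.s. unique,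
   so it does not matter which versions W1, W2 are compared. *)
Definition markov_property d (T : measurableType d) (R : realType)
    (P : probability T R) (Y : R -> T -> R) : Prop :=
  forall (t u : R) (g : R -> R), 0 <= t -> t < u ->
    measurable_fun [set: R] g -> (exists M : R, forall x, `|g x| <= M) ->
  exists W1 W2 : T -> R,
    [/\ is_cond_exp P (natural_filtration Y t) (fun x => g (Y u x)) W1,
        is_cond_exp P (g_sigma_algebra_preimage (Y t)) (fun x => g (Y u x)) W2
      & {ae P, forall x, W1 x = W2 x}].

Definition indep_rv d (T : measurableType d) (R : realType)
    (P : probability T R) (X Y : T -> R) : Prop :=
  forall A B : set R, measurable A -> measurable B ->
    (P (X @^-1` A `&` Y @^-1` B) = P (X @^-1` A) * P (Y @^-1` B))%E.

Definition almost_surely_constant d (T : measurableType d) (R : realType)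
    (P : probability T R) (X : T -> R) : Prop :=
  exists c : R, {ae P, forall x, X x = c}.

(** * Levy processes *)

Definition increment (R : realType) (s t : R) (w : skorohod R) : R :=
  coord t w - coord s w.

(* PX is the law on path space of a Levy process started at 0. *)
Definition levy_law (R : realType) (PX : probability (skorohod R) R) : Prop :=
  [/\ {ae PX, forall w, coord 0 w = 0},
      forall (s t : R) (A : set (skorohod R)) (B : set R),
        0 <= s -> s < t ->
        natural_filtration (@coord R) s A -> measurable B ->
        PX (A `&` increment s t @^-1` B) =
        (PX A * PX (increment s t @^-1` B))%E
    & forall (s t : R) (B : set R), 0 <= s -> s < t -> measurable B ->
        PX (increment s t @^-1` B) = PX (coord (t - s) @^-1` B)].

(* f t is a density of X_t; it may take the value +oo, since the bridges below
   depend on the version and are only considered where it is finite. *)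
Definition marginal_density (R : realType) (PX : probability (skorohod R) R)
    (f : R -> R -> \bar R) : Prop :=
  forall t : R, 0 < t ->
    [/\ measurable_fun setT (f t),
        forall x, (0 <= f t x)%E
      & forall B : set R, measurable B ->
          (PX (coord t @^-1` B) = \int[lebesgue_measure]_(x in B) f t x)%E].

(** * Bridges *)

Definition admissible (R : realType) (f : R -> R -> \bar R) (r z : R) : Prop :=
  (0 < f r z < +oo)%E.

(* Q is the law of the bridge from 0 to z of length r, frozen at z from time r
   on. The values of Q on the sigma-algebras F_t, t < r, and the second clause
   determine Q. *)
Definition bridge_law (R : realType) (PX : probability (skorohod R) R)
    (f : R -> R -> \bar R) (r z : R) (Q : set (skorohod R) -> \bar R) : Prop :=
  (forall (t : R) (A : set (skorohod R)), 0 <= t -> t < r ->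
     natural_filtration (@coord R) t A ->
     (Q A = \int[PX]_(w in A)
              (f (r - t)%R (z - coord t w)%R / f r z))%E)
  /\ {ae Q, forall w, forall t, r <= t -> coord t w = z}.

(* kappa is a regular conditional distribution of zeta given V *)
Definition regular_cond_dist d d1 d2 (T : measurableType d)
    (T1 : measurableType d1) (T2 : measurableType d2) (R : realType)
    (P : probability T R) (V : T -> T1) (zeta : T -> T2)
    (kappa : R.-pker T1 ~> T2) : Prop :=
  forall (C : set T1) (A : set T2), measurable C -> measurable A ->
    (P (V @^-1` C `&` zeta @^-1` A) =
     \int[pushforward P V]_(v in C) kappa v A)%E.

Definition levy_bridge (R : realType) (PX : probability (skorohod R) R)
    (f : R -> R -> \bar R) d (T : measurableType d) (P : probability T R)
    (tau Z : {RV P >-> R}) (zeta : {RV P >-> skorohod R}) : Prop :=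
  let tauZ := fun x : T => (tau x, Z x) in
  [/\ forall x, 0 < tau x,
      indep_rv P tau Z,
      {ae pushforward P tauZ, forall rz, admissible f rz.1 rz.2}
    & exists kappa : R.-pker (R * R) ~> skorohod R,
        regular_cond_dist P tauZ zeta kappa /\
        {ae pushforward P tauZ,
          forall rz, bridge_law PX f rz.1 rz.2 (kappa rz)}].

(** * Lebesgue decomposition *)

Definition lebesgue_decomposition (R : realType) (mu : set R -> \bar R)
    (a : R) (mus muac : probability R R) : Prop :=
  [/\ 0 <= a <= 1,
      forall A : set R, measurable A ->
        (mu A = (1 - a)%:E * mus A + a%:E * muac A)%E,
      muac `<< (@lebesgue_measure R)
    & exists N : set R, [/\ measurable N, lebesgue_measure N = 0%E
                          & mus (~` N) = 0%E]].

(** * Enlargement of a probability space *)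

Definition space_extension d d' (T : measurableType d) (T' : measurableType d')
    (R : realType) (P : probability T R) (P' : probability T' R)
    (p : T' -> T) : Prop :=
  measurable_fun [set: T'] p /\
  forall A, measurable A -> P' (p @^-1` A) = P A.

(* Main.v *)
Require Import Defs.
From HB Require Import structures.
From mathcomp Require Import all_boot all_order all_algebra.
From mathcomp Require Import all_classical all_reals all_analysis.
From mathcomp Require Import measurable_realfun ring lra.
(* imported again because mathcomp's [vector] shadows [Defs.coord] *)
Require Import Defs.

(**
Take tau uniform on two lengths r1 < r2. For r1 < t < r2 the past up to time t
reveals tau almost surely: on {tau = r1} the bridge is frozen from time r1 on, so
zeta_r1 = zeta_t, whereas on {tau = r2} this has probability 0. The value zeta_t
alone does not reveal tau when its law on {tau = r2} charges a set K on which
Lebesgue measure is absolutely continuous with respect to the law of Z; such a K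
exists because the law of Z has an absolutely continuous part, and K may be taken
compact. Under the Markov property every bounded function of zeta_u, for
t < u < r2, is then predicted on {tau = r2, zeta_t in K} exactly as on
{tau = r1}, that is, by freezing; hence zeta_u = zeta_t there, which is a null
event for the bridge of length r2.

It remains to find t with P(tau = r2, zeta_t in K) > 0. By the density formula for
bridges this follows from P(X_t in K, X_r2 in K) > 0, which holds for t close to r2
because X is stochastically continuous and the laws of X_t, t >= r1, are uniformly
absolutely continuous.
*)

Set Implicit Arguments.
Unset Strict Implicit.
Unset Printing Implicit Defensive.

Import Order.TTheory GRing.Theory Num.Theory.
Import numFieldNormedType.Exports.

Local Open Scope classical_set_scope.
Local Open Scope ring_scope.

(** * Integration and measures *)

Lemma ge0_integral_eq0P d (T : measurableType d) (R : realType)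
    (mu : {measure set T -> \bar R}) (D : set T) (f : T -> \bar R) :
  measurable D -> measurable_fun D f -> (forall x, D x -> (0 <= f x)%E) ->
  (\int[mu]_(x in D) f x = 0)%E <-> mu (D `&` [set x | f x != 0%E]) = 0%E.
Proof.
move=> mD mf f0; have mN : measurable (D `&` [set x | f x != 0%E]).
  exact: emeasurable_neq.
have -> : (\int[mu]_(x in D) f x = \int[mu]_(x in D) `|f x|)%E.
  by apply: eq_integral => x /set_mem Dx; rewrite gee0_abs// f0.
rewrite ae_eq_integral_abs//; split=> [[N [mN' N0 DN]]|N0].
  by apply: (subset_measure0 mN mN' _ N0) => x [Dx /eqP fx]; apply: DN => /(_ Dx).
by exists (D `&` [set x | f x != 0%E]); split=> // x /not_implyP[Dx /eqP fx].
Qed.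

(* [lebesgue_measure] lives on [measurableTypeR R], whose display differs from the
   one of [R]; the two measurable structures are convertible. *)
Lemma lebesgue_measure_translation (R : realType) (y : R) (A : set R) :
  measurable A ->
  lebesgue_measure ((fun x => x + y) @^-1` A) = lebesgue_measure A.
Proof.
move=> mA; pose T := measurableTypeR R.
have mT : measurable_fun [set: T] ((fun x => x + y) : T -> T).
  exact: measurable_funD.
rewrite -[LHS]/(pushforward (@lebesgue_measure R) ((fun x => x + y) : T -> T) A).
apply/esym/lebesgue_measure_unique => // _ [[a b]] _ <- /=.
rewrite /pushforward/=.
have -> : (fun x => x + y) @^-1` `]a, b]%classic = `]a - y, b - y]%classic.
  by apply/seteqP; split=> x /=; rewrite !in_itv /= ltrBlDr lerBrDr.
rewrite !lebesgue_measure_itv/= !lte_fin ltrD2r.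
by case: ifPn => // _; rewrite -!EFinB; congr EFin; ring.
Qed.

Lemma ge0_integral_translation (R : realType) (y : R) (A : set R)
    (f : R -> \bar R) :
  measurable A -> measurable_fun A f -> (forall x, A x -> (0 <= f x)%E) ->
  (\int[lebesgue_measure]_(x in (fun x => x + y)%R @^-1` A) f (x + y)%R =
   \int[lebesgue_measure]_(x in A) f x)%E.
Proof.
move=> mA mf f0; pose T := measurableTypeR R.
have mT : measurable_fun [set: T] ((fun x => x + y) : T -> T).
  exact: measurable_funD.
rewrite [RHS](eq_measure_integral
    (pushforward (@lebesgue_measure R) ((fun x => x + y) : T -> T))); last first.
  by move=> B mB _; exact/esym/lebesgue_measure_translation.
by rewrite (ge0_integral_pushforward mT)// => x /set_mem; exact: f0.
Qed.

(* S is the set where the Radon-Nikodym derivative of nu does not vanish. *)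
Lemma dominated_ae_equivalent d (T : measurableType d) (R : realType)
    (mu : {sigma_finite_measure set T -> \bar R})
    (nu : {finite_measure set T -> \bar R}) :
  nu `<< mu ->
  exists S : set T, [/\ measurable S, nu (~` S) = 0%E &
    forall N, measurable N -> N `<=` S -> nu N = 0%E -> mu N = 0%E].
Proof.
move=> numu; have [h [h0 hfin hint hE]] := radon_nikodym_sigma_finite numu.
have mh : measurable_fun setT h by case/integrableP: hint.
exists [set x | h x != 0%E]; split.
- by rewrite -[X in measurable X]setTI; exact: emeasurable_neq.
- rewrite hE; first by apply: integral0_eq => x /negP; rewrite negbK => /eqP.
  by apply: measurableC; rewrite -[X in measurable X]setTI; exact: emeasurable_neq.
- move=> N mN NS; rewrite hE// ge0_integral_eq0P//; last exact: measurable_funTS.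
  by rewrite setIidl.
Qed.

(** Some truncation of [A] to a bounded interval has positive finite measure. Inner regularity, with
    that measure itself as the error, leaves a compact set that cannot be null. *)
Lemma inner_compact_gt0 (R : realType) (A : set R) :
  measurable A -> (0 < lebesgue_measure A)%E ->
  exists K, [/\ compact K, K `<=` A & (0 < lebesgue_measure K)%E].
Proof.
move=> mA A0; pose B n : set R := A `&` `[- n%:R, n%:R]%classic.
have mB n : measurable (B n) by exact: measurableI.
have [n Bn0] : exists n, lebesgue_measure (B n) != 0%E.
  apply: contrapT => /forallNP B0; move: A0; apply/negP; rewrite -leNgt.
  rewrite measure_le0; apply/eqP/measure_negligible => //.
  have -> : A = \bigcup_n B n.
    apply/seteqP; split=> [x Ax|x [n _ []]//].
    exists (Num.bound `|x|) => //; split => //=.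
    by rewrite in_itv/= -ler_norml ltW// archi_boundP.
  apply: (@negligible_bigcup _ _ _ (@lebesgue_measure R)) => n.
  apply/negligibleP; first exact: mB.
  by apply/eqP/negPn/negP; exact: B0.
have Bfin : (lebesgue_measure (B n) < +oo)%E.
  apply: (@le_lt_trans _ _ (lebesgue_measure `[- n%:R : R, n%:R]%classic)).
    apply: le_measure; [apply/mem_set; exact: mB| |by move=> x []].
    by apply/mem_set; exact: measurable_itv.
  by rewrite lebesgue_measure_itv/=; case: ifPn; rewrite // -EFinB ltry.
have e0 : 0 < fine (lebesgue_measure (B n)).
  by rewrite fine_gt0// lt0e Bn0 measure_ge0.
have [K [cK KB muBK]] := lebesgue_regularity_inner (mB n) Bfin e0.
exists K; split => //; first by move=> x /KB[].
have mK := compact_measurable cK.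
rewrite lt0e measure_ge0 andbT; apply/eqP => K0.
move: muBK; rewrite fineK ?ge0_fin_numE ?measure_ge0//.
suff DE : lebesgue_measure (B n `\` K) = lebesgue_measure (B n).
  by rewrite [X in (X < _)%E]DE ltxx.
have -> : lebesgue_measure (B n `\` K) =
    (lebesgue_measure (B n) - lebesgue_measure (B n `&` K))%E.
  by apply: measureD => //; exact: mB.
by rewrite setIidr// K0 sube0.
Qed.

(** * Probability spaces built by completion and from kernels *)

Section probability_of_measure.
Context d (T : measurableType d) (R : realType).
Variables (m : {measure set T -> \bar R}) (m1 : m setT = 1%E).

(* The dummy [let] makes the section hypothesis an argument of the definition, as
   the HB instances below need; likewise for the kernels defined later. *)
Definition probability_of_measure : set T -> \bar R := let _ := m1 in m.

HB.instance Definition _ := Measure.on probability_of_measure.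
HB.instance Definition _ :=
  Measure_isProbability.Build _ _ _ probability_of_measure m1.

End probability_of_measure.

(** The Caratheodory extension of [P] lives on the same points and is complete; the identity is the
    projection. *)
Lemma probability_completion d (T : measurableType d) (R : realType)
    (P : probability T R) :
  exists (d' : measure_display) (T' : measurableType d')
    (P' : probability T' R) (q : T' -> T),
  measure_is_complete P' /\ space_extension P P' q.
Proof.
pose mu := (mu_ext P : {outer_measure set T -> \bar R}).
pose T' : measurableType _ := caratheodory_type mu.
have msub (A : set T) : measurable A -> measurable (A : set T').
  by move=> mA; apply: sub_caratheodory; exact: sub_sigma_algebra.
have muE (A : set T) : measurable A -> mu A = P A.
  exact: measurable_mu_extE.
have muT : @completed_measure_extension _ _ _ P (setT : set T') = 1%E.
  by rewrite -(@probability_setT _ _ _ P) -muE.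
pose P' : probability T' R := probability_of_measure muT.
exists _, T', P', (fun x => x); split.
  exact: measure_is_complete_caratheodory.
split=> [_ A mA|A mA]; first by rewrite setTI; exact: msub.
exact: muE.
Qed.

Section kernel_comap.
Context d1 d2 d3 (X : measurableType d1) (Y : measurableType d2)
  (T : measurableType d3) (R : realType).
Variables (k : R.-pker Y ~> T) (f : X -> Y) (mf : measurable_fun [set: X] f).

Definition kernel_comap : X -> {measure set T -> \bar R} := let _ := mf in k \o f.

Let measurable_kernel_comap U : measurable U ->
  measurable_fun [set: X] (kernel_comap ^~ U).
Proof.
by move=> mU; apply: (measurableT_comp (measurable_kernel k U mU) mf).
Qed.

HB.instance Definition _ :=
  isKernel.Build _ _ _ _ _ kernel_comap measurable_kernel_comap.

Let kernel_comap_prob x : kernel_comap x [set: T] = 1%E.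
Proof. exact: prob_kernel. Qed.

HB.instance Definition _ :=
  Kernel_isProbability.Build _ _ _ _ _ kernel_comap kernel_comap_prob.

End kernel_comap.

Lemma joint_probability d d' (T : measurableType d) (T' : measurableType d')
    (R : realType) (P : probability T R) (k : R.-pker T ~> T') :
  exists P' : probability (T * T')%type R, forall A B, measurable A ->
    measurable B -> (P' (A `*` B) = \int[P]_(x in A) k x B)%E.
Proof.
(* [P] is seen as a kernel from a one-point space, so that the product of kernels applies to it. *)
have mP : measurable_fun [set: unit] (fun _ : unit => P : pprobability T R).
  exact: measurable_cst.
have msnd : measurable_fun [set: unit * T] snd by [].
pose J := mkproduct (kprobability mP) (kernel_comap k msnd) tt.
have JE A B : measurable A -> measurable B ->
    (J (A `*` B) = \int[P]_(x in A) k x B)%E.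
  move=> mA mB; rewrite [RHS]integral_mkcond.
  apply: eq_integral => x _; rewrite patchE.
  transitivity (\int[k x]_z (\1_(A `*` B) (x, z))%:E)%E => //.
  case: ifPn => xA.
    under eq_integral do rewrite indicE in_setX xA/= -indicE.
    by rewrite integral_indic// setIT.
  rewrite integral0_eq// => z _.
  by rewrite indicE in_setX (negbTE xA).
have J1 : J setT = 1%E.
  rewrite -setXTT JE//; under eq_integral do rewrite prob_kernel.
  by rewrite (integral_cst P)// mul1e; exact: probability_setT.
by exists (probability_of_measure J1).
Qed.

(** * Levy processes *)

Lemma natural_filtration_measurable d (R : realType) (T : measurableType d)
    (Y : R -> T -> R) (t : R) (A : set T) :
  (forall s, measurable_fun [set: T] (Y s)) ->
  natural_filtration Y t A -> measurable A.
Proof.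
move=> mY; apply: smallest_sub; first exact: sigma_algebra_measurable.
by move=> _ [s _ [B mB <-]]; exact: mY.
Qed.

Lemma natural_filtration_coord (R : realType) (T : pointedType)
    (Y : R -> T -> R) (s t : R) (B : set R) :
  0 <= s <= t -> measurable B -> natural_filtration Y t (Y s @^-1` B).
Proof.
move=> st mB; apply: sub_sigma_algebra; exists s => //.
by exists B => //; rewrite setTI.
Qed.

Lemma natural_filtration_le (R : realType) (T : pointedType)
    (Y : R -> T -> R) (s t : R) : s <= t ->
  natural_filtration Y s `<=` natural_filtration Y t.
Proof.
move=> st; apply: sub_smallest2r; first exact: smallest_sigma_algebra.
move=> A [r /= /andP[r0 rs] YA]; exists r => //=.
by rewrite r0 (le_trans rs).
Qed.

Lemma measurable_coord (R : realType) (t : R) :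
  measurable_fun [set: skorohod R] (coord t).
Proof.
wlog t0 : t / 0 <= t => [mcoord|_ B mB].
  have [|t0] := leP 0 t; first exact: mcoord.
  rewrite (_ : coord t = coord 0); first exact: mcoord.
  by apply/funext => w; case: (path_cadlag w) => + _ _; apply.
by apply: sub_sigma_algebra; exists t => //; exists B.
Qed.

Lemma measurable_increment (R : realType) (s t : R) :
  measurable_fun [set: skorohod R] (increment s t).
Proof. by apply: measurable_funB; exact: measurable_coord. Qed.

Lemma measurable_prob_xsection d (T : measurableType d) (R : realType)
    (P : probability T R) (Y : T -> R) (E : set (R * R)) :
  measurable_fun [set: T] Y -> measurable E ->
  measurable_fun [set: R] (fun x => P (Y @^-1` (xsection E x))).
Proof.
move=> mY mE.
pose Y' : {mfun T >-> R} := HB.pack Y (isMeasurableFun.Build _ _ _ _ _ mY).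
rewrite -[X in measurable_fun _ X]/(distribution P Y' \o xsection E).
exact: measurable_fun_xsection.
Qed.

(** By independence the law of the pair agrees with the product of the two laws on rectangles, hence
    on all of the product sigma-algebra; the product measure of [E] is the integral of its
    sections. *)
Lemma indep_rv_prob_pair d (T : measurableType d) (R : realType)
    (P : probability T R) (X Y : T -> R) (E : set (R * R)) :
  measurable_fun [set: T] X -> measurable_fun [set: T] Y ->
  indep_rv P X Y -> measurable E ->
  P [set x | E (X x, Y x)] = (\int[P]_x P (Y @^-1` (xsection E (X x))))%E.
Proof.
move=> mX mY XY mE.
pose X' : {mfun T >-> R} := HB.pack X (isMeasurableFun.Build _ _ _ _ _ mX).
pose Y' : {mfun T >-> R} := HB.pack Y (isMeasurableFun.Build _ _ _ _ _ mY).
have mXY : measurable_fun [set: T] (fun x => (X x, Y x)).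
  exact: measurable_fun_pair.
pose XY' : {mfun T >-> (R * R)%type} := HB.pack (fun x => (X x, Y x))
  (isMeasurableFun.Build _ _ _ _ _ mXY).
rewrite -[LHS]/(distribution P XY' E).
rewrite -(@product_measure_unique _ _ _ _ _ (distribution P X') (distribution P Y'))//.
rewrite -[LHS]/(\int[distribution P X']_x (distribution P Y' \o xsection E) x)%E.
rewrite ge0_integral_distribution//.
exact: measurable_fun_xsection.
Qed.

Section levy_process.
Context (R : realType) (PX : probability (skorohod R) R) (f : R -> R -> \bar R).
Hypotheses (hX : levy_law PX) (hf : marginal_density PX f).

Lemma marginal_abs_continuous (t : R) (N : set R) : 0 < t -> measurable N ->
  lebesgue_measure N = 0%E -> PX (coord t @^-1` N) = 0%E.
Proof.
move=> t0 mN N0; have [mf f0 ->//] := hf t0.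
by apply: null_set_integral => //; exact: measurable_funTS.
Qed.

Lemma increment_law (s t : R) (B : set R) : 0 <= s -> s < t -> measurable B ->
  PX (increment s t @^-1` B) = PX (coord (t - s) @^-1` B).
Proof. by case: hX => _ _; apply. Qed.

(** The increment has the law of [X] at time [t - s], which has a density and so no atom at 0. *)
Lemma coord_eq_null (s t : R) : 0 <= s -> s < t ->
  PX [set w | coord s w = coord t w] = 0%E.
Proof.
move=> s0 st; have -> : [set w | coord s w = coord t w] =
    increment s t @^-1` [set 0 : R].
  apply/seteqP; split=> w /=; rewrite /increment; first by move=> ->; rewrite subrr.
  by move/eqP; rewrite subr_eq0 => /eqP.
rewrite increment_law// marginal_abs_continuous ?subr_gt0//.
exact: lebesgue_measure_set1.
Qed.

Lemma indep_increment (s t : R) : 0 <= s -> s < t ->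
  indep_rv PX (coord s) (increment s t).
Proof.
move=> s0 st A B mA mB; case: hX => _ + _; apply => //.
by apply: natural_filtration_coord; rewrite // s0 lexx.
Qed.

(** Given the value at [s], the independent increment has density [f (t - s)], translated by that
    value. The inner integral runs over the end point [z], so that exchanging the integrals later
    brings in the bridge pinned at [z]. *)
Lemma prob_two_times (s t : R) (A : set R) : 0 < s -> s < t -> measurable A ->
  PX (coord s @^-1` A `&` coord t @^-1` A) =
  (\int[PX]_(w in coord s @^-1` A)
     \int[lebesgue_measure]_(z in A) f (t - s) (z - coord s w)%R)%E.
Proof.
move=> s0 st mA.
have mE : measurable ([set z : R * R | A z.1] `&` [set z : R * R | A (z.1 + z.2)]).
  apply: measurableI; rewrite -[X in measurable X]setTI.
    exact: (@measurable_fst _ _ R R).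
  by apply: (measurable_funD (f := fst) (g := snd)).
have := indep_rv_prob_pair (@measurable_coord R s) (@measurable_increment R s t)
  (indep_increment (ltW s0) st) mE.
have -> : [set x | ([set z : R * R | A z.1] `&` [set z | A (z.1 + z.2)])
    (coord s x, increment s t x)] = coord s @^-1` A `&` coord t @^-1` A.
  by apply/seteqP; split=> w /=; rewrite /increment addrC subrK.
move=> ->; rewrite [RHS]integral_mkcond; apply: eq_integral => w _.
rewrite patchE; case: ifPn => [|/negP] ; rewrite inE => Aw; last first.
  rewrite (_ : _ @^-1` _ = set0) ?measure0//; apply/seteqP; split=> v //.
  by rewrite /xsection/= inE => -[].
have -> : increment s t @^-1`
    xsection ([set z | A z.1] `&` [set z | A (z.1 + z.2)]) (coord s w) =
  increment s t @^-1` ((fun x => x + coord s w) @^-1` A).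
  apply/seteqP; split=> v; rewrite /xsection/= inE/=.
    by move=> [_]; rewrite addrC.
  by rewrite addrC.
have mT : measurable ((fun x => x + coord s w) @^-1` A).
  rewrite -[X in measurable X]setTI; exact: measurable_funD.
rewrite increment_law ?(ltW s0)//.
have [|mf f0 ->//] := hf (t := t - s); first by rewrite subr_gt0.
rewrite -(ge0_integral_translation (coord s w) mA)//; last 1 first.
- apply: measurable_funTS; apply: measurableT_comp => //; exact: measurable_funB.
by apply: eq_integral => x _; rewrite addrK.
Qed.

End levy_process.

(** * Uniform absolute continuity and stochastic continuity *)

Lemma dominated_small d (T : measurableType d) (R : realType)
    (mu : {measure set T -> \bar R}) (nu : {finite_measure set T -> \bar R})
    (e : R) :
  nu `<< mu -> 0 < e ->
  exists2 delta : R, 0 < delta &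
    forall A, measurable A -> (mu A < delta%:E)%E -> (nu A < e%:E)%E.
Proof.
move=> numu e0; pose nu' : {charge set T -> \bar R} := charge_of_finite_measure nu.
have [A [B AB]] := Hahn_decomposition nu'.
(* Viewed as a charge, [nu] is bounded by its variation, and the variation has the epsilon-delta
   form of absolute continuity. *)
have [delta [delta0 H]] := charge_variation_continuous (nu := nu') AB numu e0.
exists delta => // C mC muC; apply: le_lt_trans (H _ mC muC).
by apply: le_trans (abse_charge_variation AB mC); rewrite lee_abs.
Qed.

(** Near each point of [K], half the radius of a ball inside [U] is spent on moving the point and
    half on reaching [y]; compactness in its near-covering form makes the choice of [c] uniform. *)
Lemma compact_thickening (R : realType) (K U : set R) :
  compact K -> open U -> K `<=` U ->
  exists2 c : R, 0 < c & forall x y, K x -> `|x - y| < c -> U y.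
Proof.
move=> /compact_near_coveringP cK oU KU.
have H : \forall c \near 0^'+, K `<=` (fun x => forall y, `|x - y| < c -> U y).
  apply: (cK R (0^'+) (fun (c : R) (x : R) => forall y, `|x - y| < c -> U y)) => x Kx.
  have /nbhs_ballP[d /= d0 xdU] : nbhs x U.
    by apply: open_nbhs_nbhs; split=> //; exact: KU.
  exists (ball x (d / 2), [set c | c < d / 2]).
    split=> /=; first by apply: nbhsx_ballx; rewrite divr_gt0.
    by apply: nbhs_right_lt; rewrite divr_gt0.
  move=> [x' c] [/= xx' cd] y x'y; apply: xdU.
  rewrite /ball/= in xx' *.
  rewrite (_ : x - y = (x - x') + (x' - y)); last by ring.
  by rewrite (le_lt_trans (ler_normD _ _))// (splitr d) ltrD// (lt_trans x'y).
case: H => d /= d0 H; exists (d / 2); first by rewrite divr_gt0.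
move=> x y Kx xy; apply: (H (d / 2)) Kx _ xy; last by rewrite divr_gt0.
rewrite /ball/= sub0r normrN gtr0_norm ?divr_gt0// ltr_pdivrMr//.
by rewrite ltr_pMr// ltr1n.
Qed.

Section levy_continuity.
Context (R : realType) (PX : probability (skorohod R) R) (f : R -> R -> \bar R).
Hypotheses (hX : levy_law PX) (hf : marginal_density PX f).

(** For [t > s] the law at [t] is an average of translates of the law at [s], by independence of the
    increment. Translates of [N] have the same Lebesgue measure, so the [delta] found at time [s]
    serves all later times. *)
Lemma marginal_uniformly_small (s e : R) : 0 < s -> 0 < e ->
  exists2 delta : R, 0 < delta &
    forall (N : set R) t, measurable N -> (lebesgue_measure N < delta%:E)%E -> s <= t ->
      (PX (coord t @^-1` N) <= e%:E)%E.
Proof.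
move=> s0 e0.
pose X : {mfun skorohod R >-> measurableTypeR R} := HB.pack
  (coord s : skorohod R -> measurableTypeR R)
  (isMeasurableFun.Build _ _ (skorohod R) (measurableTypeR R) (coord s)
    (@measurable_coord R s)).
have [|delta delta0 H] := @dominated_small _ _ _ lebesgue_measure
    (distribution PX X) e _ e0.
  apply/null_content_dominatesP => A mA A0.
  exact: (marginal_abs_continuous hf).
exists delta => // N t mN Nd; rewrite le_eqVlt => /predU1P[<-|st].
  by apply/ltW/H.
have mE : measurable ((fun z : R * R => z.1 + z.2) @^-1` N).
  rewrite -[X in measurable X]setTI.
  by apply: (measurable_funD (f := fst) (g := snd)).
have XY : indep_rv PX (increment s t) (coord s).
  by move=> A B mA mB; rewrite setIC (indep_increment hX (ltW s0) st)// muleC.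
have := indep_rv_prob_pair (measurable_increment s t) (measurable_coord s) XY mE.
have -> : [set w | ((fun z : R * R => z.1 + z.2) @^-1` N) (increment s t w, coord s w)]
    = coord t @^-1` N.
  by apply/seteqP; split=> w /=; rewrite /increment subrK.
move=> ->.
apply: (@le_trans _ _ (\int[PX]_w (cst e%:E w))%E).
  apply: ge0_le_integral => //.
  - exact: (measurableT_comp (measurable_prob_xsection PX (measurable_coord s) mE)
      (measurable_increment s t)).
  - move=> w _; apply/ltW/H; first exact: measurable_xsection.
    rewrite (_ : xsection _ _ = (fun x => x + increment s t w) @^-1` N).
      by rewrite [X in (X < _)%E](lebesgue_measure_translation _ mN).
    by apply/seteqP; split=> v; rewrite /xsection/= inE/= addrC.
rewrite integral_cst//; rewrite [X in (_ * X)%E](_ : _ = 1%E) ?mule1//.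
exact: probability_setT.
Qed.

(** Right continuity of the paths at 0 suffices: along a sequence of times tending to 0, almost
    every path eventually stays within [c] of 0, so the tail events [E k] increase to an event of
    probability 1. *)
Lemma stochastic_continuity (c e eta : R) : 0 < c -> 0 < e -> 0 < eta ->
  exists2 h : R, 0 < h < eta & (PX [set w | (c <= `|coord h w|)%R] < e%:E)%E.
Proof.
(* The shift by 2 keeps every time strictly below [eta], including the one with index 0. *)
move=> c0 e0 eta0; pose h n : R := eta / n.+2%:R.
have h0 n : 0 < h n by rewrite divr_gt0.
pose B n := [set w : skorohod R | `|coord (h n) w| < c].
have mB n : measurable (B n).
  rewrite -[X in measurable X]setTI.
  rewrite (_ : B n = (fun w => `|coord (h n) w|) @^-1` `]-oo, c[%classic); last first.
    by apply/seteqP; split=> w /=; rewrite in_itv.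
  apply: measurableT_comp => //; exact: measurable_coord.
pose E k := \bigcap_j B (k + j)%N.
have mE k : measurable (E k) by exact: bigcapT_measurable.
have ndE : nondecreasing_seq E.
  move=> m n mn; apply/subsetPset => w Em j _.
  by have := Em (n - m + j)%N I; rewrite addnA subnKC.
have UE : PX (\bigcup_k E k) = 1%E.
  case: hX => -[N [mN N0 XN]] _ _.
  have mU : measurable (\bigcup_k E k) by exact: bigcupT_measurable.
  apply/eqP; rewrite eq_le probability_le1//=.
  have <- : PX (~` N) = 1%E by rewrite probability_setC// N0 sube0.
  apply: le_measure; rewrite ?inE//; first exact: measurableC.
  move=> w Nw; have w0 : coord 0 w = 0 by apply: contrapT => /XN.
  have [_ /(_ 0 (lexx _)) wr _] := path_cadlag w.
  have /cvgr_dist_lt/(_ c c0) [d /= d0 wd] := wr.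
  exists (Num.bound (eta / d)) => // j _; rewrite /B/=.
  have := wd (h (Num.bound (eta / d) + j)%N).
  rewrite /= sub0r normrN -[w 0]/(coord 0 w) w0 sub0r normrN; apply => //.
  rewrite gtr0_norm// ltr_pdivrMr// mulrC -ltr_pdivrMr//.
  apply: (lt_le_trans (archi_boundP _)); first by rewrite divr_ge0// ltW.
  by rewrite ler_nat (leq_trans (leq_addr j _))// -addn2 leq_addr.
have cE : PX (E n) @[n --> \oo] --> 1%E.
  by rewrite -UE; apply: nondecreasing_cvg_mu => //; exact: bigcupT_measurable.
have [k Ek] : exists k, ((1 - e)%:E < PX (E k))%E.
  apply: contrapT => /forallNP H.
  have : (1%:E <= (1 - e)%:E :> \bar R)%E.
    rewrite -(cvg_lim _ cE)//; apply: lime_le; first by apply/cvg_ex; exists 1%E.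
    by apply: nearW => n; rewrite leNgt; apply/negP; exact: H.
  by rewrite lee_fin => ?; lra.
exists (h k).
  rewrite h0 ltr_pdivrMr// ltr_pMr// ltr1n//.
rewrite (le_lt_trans (y := PX (~` E k)))//.
  apply: le_measure; rewrite ?inE; last 2 first.
  - exact: measurableC.
  - by move=> w /= cw Ew; have := Ew 0%N I; rewrite /B/= addn0 ltNge cw.
  rewrite (_ : mkset _ = ~` B k); first exact: measurableC.
  by apply/seteqP; split=> w /=; rewrite leNgt => /negP.
rewrite probability_setC// lteBlDr//; last exact: fin_num_measure.
by rewrite -lteBlDl// -EFinB.
Qed.

Lemma prob_two_times_gt0 (s r : R) (K : set R) : 0 < s -> s < r -> compact K ->
  (0 < PX (coord r @^-1` K))%E ->
  exists2 t : R, s < t < r & (0 < PX (coord t @^-1` K `&` coord r @^-1` K))%E.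
Proof.
move=> s0 sr cK K0; have mK := compact_measurable cK.
have mX t (A : set R) : measurable A -> measurable (coord t @^-1` A).
  by move=> mA; rewrite -[X in measurable X]setTI; exact: measurable_coord.
have pfin : PX (coord r @^-1` K) \is a fin_num by apply: fin_num_measure; exact: mX.
(* One third: two exceptional events of probability at most [e] cannot exhaust the event that [X] is
   in [K] at time [r]. *)
pose e := fine (PX (coord r @^-1` K)) / 3.
have e0 : 0 < e by rewrite divr_gt0// fine_gt0// K0 ltey_eq pfin.
(* Uniformity over times from [s] on allows [delta], [U] and [c] to be fixed before the time
   [r - h]. *)
have [delta delta0 small] := marginal_uniformly_small s0 e0.
have [U [oU KU UK]] := lebesgue_regularity_outer mK (compact_finite_measure cK) delta0.
have mU : measurable U by exact: open_measurable.
have [c c0 KcU] := compact_thickening cK oU KU.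
have rs0 : 0 < r - s by rewrite subr_gt0.
have [h /andP[h0 hrs] hc] := stochastic_continuity c0 e0 rs0.
have htr : s < r - h < r by apply/andP; split; lra.
exists (r - h) => //; have /andP[st tr] := htr.
have t0 : 0 <= r - h by lra.
rewrite lt0e measure_ge0 andbT; apply/eqP => KK0.
have mc : measurable [set x : R | c <= `|x|].
  rewrite (_ : mkset _ = ~` ball 0 c).
    by apply: measurableC; apply: open_measurable; exact: ball_open.
  by apply/seteqP; split=> x; rewrite /ball/= sub0r normrN leNgt => /negP.
have Kle : (PX (coord r @^-1` K) <= PX (coord (r - h) @^-1` (U `\` K)) +
    PX (increment (r - h) r @^-1` [set x | (c <= `|x|)%R]))%E.
  have mI : measurable (increment (r - h) r @^-1` [set x : R | c <= `|x|]).
    by rewrite -[X in measurable X]setTI; exact: measurable_increment.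
  have mKK : measurable (coord (r - h) @^-1` K `&` coord r @^-1` K).
    by apply: measurableI; exact: mX.
  have mUK : measurable (coord (r - h) @^-1` (U `\` K)).
    by apply: mX; exact: measurableD.
  (* If X_r is in K, then either X_t is in the thickening U of K or the increment
     from t = r - h to r is at least c. *)
  pose C : set (skorohod R) := coord (r - h) @^-1` K `&` coord r @^-1` K `|`
    coord (r - h) @^-1` (U `\` K).
  have mC : measurable C by exact: measurableU.
  have CE : PX C = PX (coord (r - h) @^-1` (U `\` K)).
    by rewrite /C setUC measureU0.
  rewrite -CE; apply: le_trans (measureU2 PX mC mI).
  apply: le_measure; rewrite ?inE; [exact: mX|exact: measurableU|move=> w /= Kw].
  have [cw|cw] := leP c `|increment (r - h) r w|; [by right|left].
  have Uw : U (coord (r - h) w) by apply: KcU Kw _; exact: cw.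
  by have [Kt|Kt] := pselect (K (coord (r - h) w)); [left|right].
have rh : r - (r - h) = h by ring.
have : (PX (coord r @^-1` K) < e%:E + e%:E)%E.
  apply: le_lt_trans Kle _; apply: lee_ltD => //.
  - by apply: fin_num_measure; apply: mX; exact: measurableD.
  - by apply: small; [exact: measurableD|exact: UK|exact: ltW].
  - by rewrite increment_law// rh.
rewrite -(fineK pfin) -EFinD lte_fin /e => ?; move: e0; rewrite /e => ?; lra.
Qed.

End levy_continuity.

(** * Bridges and their conditional laws *)

Section bridge.
Context (R : realType) (PX : probability (skorohod R) R) (f : R -> R -> \bar R).
Hypothesis hf : marginal_density PX f.

Lemma measurable_bridge_density (t u z : R) : 0 < u ->
  measurable_fun [set: skorohod R] (fun w => f u (z - coord t w)).
Proof.
move=> u0; have [mf _ _] := hf u0.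
apply: (measurableT_comp mf); apply: measurable_funB => //.
exact: measurable_coord.
Qed.

Section fixed_bridge.
Variables (r z : R) (Q : {measure set (skorohod R) -> \bar R}).
Hypothesis hQ : bridge_law PX f r z Q.

Lemma bridge_null (t : R) (A : set (skorohod R)) : 0 <= t -> t < r ->
  natural_filtration (@coord R) t A -> PX A = 0%E -> Q A = 0%E.
Proof.
move=> t0 tr FA A0; have [/(_ t A t0 tr FA) -> _] := hQ.
apply: null_set_integral => //.
  by apply: natural_filtration_measurable FA; exact: measurable_coord.
apply: measurable_funTS; apply: emeasurable_funM => //.
by apply: measurable_bridge_density; rewrite subr_gt0.
Qed.

Lemma bridge_frozen (A : set (skorohod R)) : measurable A ->
  (forall w, A w -> exists2 t, r <= t & coord t w <> z) -> Q A = 0%E.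
Proof.
move=> mA Az; have [_ [N [mN N0 zN]]] := hQ.
by apply: (subset_measure0 mA mN _ N0) => w /Az[t rt wz]; apply: zN => /(_ t rt).
Qed.

(** Admissibility keeps [f r z] finite, so the normalising factor is not 0 and the integral itself
    must vanish. *)
Lemma bridge_eq0 (t : R) (A : set (skorohod R)) : 0 <= t -> t < r ->
  natural_filtration (@coord R) t A -> admissible f r z -> Q A = 0%E ->
  (\int[PX]_(w in A) f (r - t) (z - coord t w)%R = 0)%E.
Proof.
move=> t0 tr FA /andP[f0 foo]; have [/(_ t A t0 tr FA) -> _] := hQ.
have rt : 0 < r - t by rewrite subr_gt0.
have [_ fge0 _] := hf rt.
rewrite ge0_integralZr//; last first.
- by rewrite inve_ge0 ltW.
- by apply: measurable_funTS; exact: measurable_bridge_density.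
- by apply: natural_filtration_measurable FA; exact: measurable_coord.
by move/eqP; rewrite mule_eq0 inve_eq0 (lt_eqF foo) orbF => /eqP.
Qed.

End fixed_bridge.
End bridge.

Section conditional_law.
Context d (T : measurableType d) (R : realType) (P : probability T R)
  (tau Z : {RV P >-> R}).
Local Notation tauZ := (fun x => (tau x, Z x)).
Hypothesis tauZ_indep : indep_rv P tau Z.
Variables (r : R) (r_gt0 : P (tau @^-1` [set r]) != 0%E).

(** By independence the first probability is a product, whose factor for [tau = r] is not 0. *)
Lemma joint_law_section_null (N : set (R * R)) : measurable N ->
  P (tauZ @^-1` N `&` tau @^-1` [set r]) = 0%E <->
  distribution P Z [set z | N (r, z)] = 0%E.
Proof.
move=> mN; have mNr : measurable [set z | N (r, z)].
  by rewrite -[X in measurable X]setTI; exact: (measurable_pair1 r).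
have -> : tauZ @^-1` N `&` tau @^-1` [set r] =
    tau @^-1` [set r] `&` Z @^-1` [set z | N (r, z)].
  by apply/seteqP; split=> x /=; [move=> [+ tx]; rewrite tx|move=> [->]].
rewrite tauZ_indep//; split=> [/eqP|H].
  by rewrite mule_eq0 (negbTE r_gt0) => /eqP.
by rewrite [X in (_ * X)%E](_ : _ = 0%E) ?mule0.
Qed.

Lemma joint_law_ae_section (p : R * R -> Prop) :
  {ae pushforward P tauZ, forall v, p v} ->
  {ae distribution P Z, forall z, p (r, z)}.
Proof.
move=> [N [mN N0 pN]]; exists [set z | N (r, z)]; split.
- by rewrite -[X in measurable X]setTI; exact: (measurable_pair1 r).
- apply/joint_law_section_null => //.
  have mNt : measurable (tauZ @^-1` N).
    by rewrite -[X in measurable X]setTI; exact: measurable_fun_pair.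
  by apply: (subset_measure0 _ mNt _ N0) => [|x []//]; exact: measurableI.
- by move=> z /= pz; exact: pN.
Qed.

(** The probability is the integral of [kappa v A] over the slice of length [r], and a nonnegative
    integral vanishes exactly when its integrand does almost everywhere. Questions of negligibility
    on [tau = r] thus become questions on single bridges. *)
Lemma cond_dist_null (zeta : {RV P >-> skorohod R})
    (kappa : R.-pker (R * R)%type ~> skorohod R) (A : set (skorohod R)) :
  regular_cond_dist P tauZ zeta kappa -> measurable A ->
  P (tau @^-1` [set r] `&` zeta @^-1` A) = 0%E <->
  distribution P Z [set z | kappa (r, z) A != 0%E] = 0%E.
Proof.
move=> rcd mA.
have mtauZ : measurable_fun [set: T] tauZ by exact: measurable_fun_pair.
have mr : measurable ([set r] `*` [set: R]) by exact: measurableX.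
have mk := measurable_kernel kappa A mA.
have -> : tau @^-1` [set r] `&` zeta @^-1` A =
    tauZ @^-1` ([set r] `*` [set: R]) `&` zeta @^-1` A.
  by apply/seteqP; split=> x /=; [move=> []|move=> [[]]].
rewrite rcd// ge0_integral_pushforward//; last exact: measurable_funTS.
rewrite ge0_integral_eq0P//; last 2 first.
- by rewrite -[X in measurable X]setTI; exact: mtauZ.
- by apply: measurable_funTS; exact: (measurableT_comp mk).
have mN : measurable [set v | kappa v A != 0%E].
  rewrite -[X in measurable X]setTI; exact: emeasurable_neq.
rewrite [X in P X = _ <-> _](_ : _ =
  tauZ @^-1` [set v | kappa v A != 0%E] `&` tau @^-1` [set r]);
  first exact: joint_law_section_null mN.
by apply/seteqP; split=> x /=; [move=> [[]]|move=> []].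
Qed.

End conditional_law.

(** * Failure of the Markov property *)

Section cond_exp.
Context d (T : measurableType d) (R : realType) (P : probability T R).

Lemma integral_eq_negligible (D : set T) (U V : T -> R) :
  measurable D -> P.-integrable [set: T] (EFin \o U) ->
  P.-integrable [set: T] (EFin \o V) -> (forall x, D x -> U x <= V x) ->
  (\int[P]_(x in D) (U x)%:E = \int[P]_(x in D) (V x)%:E)%E ->
  P.-negligible (D `&` [set x | U x <> V x]).
Proof.
move=> mD iU iV UV UVE.
have iUD : P.-integrable D (EFin \o U) by exact: integrableS iU.
have iVD : P.-integrable D (EFin \o V) by exact: integrableS iV.
have mVU : measurable_fun D (fun x => (V x)%:E - (U x)%:E)%E.
  by apply: emeasurable_funB; [case/integrableP: iVD|case/integrableP: iUD].
have int0 : (\int[P]_(x in D) ((V x)%:E - (U x)%:E) = 0)%E.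
  rewrite integralB// UVE subee//; exact: integrable_fin_num iVD.
have VU0 x : D x -> (0 <= (V x)%:E - (U x)%:E)%E.
  by move=> /UV; rewrite -EFinB lee_fin subr_ge0.
move/(ge0_integral_eq0P P mD mVU VU0): int0 => D0.
exists (D `&` [set x | ((V x)%:E - (U x)%:E)%E != 0%E]); split => //.
  exact: emeasurable_neq.
move=> x [Dx /= UVx]; split => //=; rewrite -EFinB eqe subr_eq0.
by apply/eqP => VUx; exact: UVx.
Qed.

Variables (G : set (set T)) (Y W : T -> R).
Hypotheses (Gm : G `<=` measurable) (GI : setI_closed G)
  (iY : P.-integrable [set: T] (EFin \o Y)) (YW : is_cond_exp P G Y W).

(** On every subset of [E] belonging to [G], the integrals of [W] and of 1 agree. This is applied to
    the parts of [E] where [W] is below 1 and above 1. *)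
Lemma cond_exp_const1 (E : set T) : G E ->
  P.-negligible (E `&` [set x | Y x <> 1]) ->
  P.-negligible (E `&` [set x | W x <> 1]).
Proof.
move=> GE E0; have [GW iW WY] := YW.
have i1 : P.-integrable [set: T] (EFin \o cst (1 : R)).
  by apply: finite_measure_integrable_cst.
have int1 D : G D -> D `<=` E ->
    (\int[P]_(x in D) (W x)%:E = \int[P]_(x in D) (cst 1 x)%:E)%E.
  move=> GD DE; rewrite WY//; apply: ae_eq_integral => //.
  - exact: Gm.
  - by apply: measurable_funTS; case/integrableP: iY.
  - by apply: measurable_funTS; case/integrableP: i1.
  - case: E0 => N [mN N0 EN]; exists N; split => // x /= /not_implyP[Dx Y1].
    by apply: EN; split; [exact: DE|move=> /= Y1x; apply: Y1; rewrite Y1x].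
have GW1 (B : set R) : measurable B -> G (E `&` W @^-1` B).
  by move=> mB; apply: GI => //; exact: GW.
have lt1 := GW1 `]-oo, 1[%classic (measurable_itv _).
have gt1 := GW1 `]1, +oo[%classic (measurable_itv _).
have W1 : P.-negligible (E `&` W @^-1` `]-oo, 1[%classic `&` [set x | W x <> cst 1 x]).
  apply: integral_eq_negligible => //; [exact: Gm|move=> x []|].
    by rewrite /= in_itv/= => _ /ltW.
  by apply: int1 => // x [].
have W2 : P.-negligible (E `&` W @^-1` `]1, +oo[%classic `&` [set x | cst 1 x <> W x]).
  apply: integral_eq_negligible => //; [exact: Gm|move=> x []|].
    by rewrite /= in_itv/= andbT => _ /ltW.
  by apply/esym/int1 => // x [].
apply: negligibleS (negligibleU W1 W2) => x [Ex /= Wx].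
have := Wx; rewrite /= !in_itv/= andbT.
case: (ltgtP (W x) 1) => // Wx1 _; [left|right]; split => //.
by move=> /esym.
Qed.

(** Over [E] the integral of [Y] is that of [W], hence that of 1; the bound by 1 turns this into
    equality almost everywhere. *)
Lemma cond_exp_const1_converse (E : set T) : G E ->
  (forall x, Y x <= 1) ->
  P.-negligible (E `&` [set x | W x <> 1]) ->
  P.-negligible (E `&` [set x | Y x <> 1]).
Proof.
move=> GE Y1 E0; have [GW iW WY] := YW.
have i1 : P.-integrable [set: T] (EFin \o cst (1 : R)).
  by apply: finite_measure_integrable_cst.
apply: (@integral_eq_negligible E Y (cst 1)) => //; first exact: Gm.
rewrite -WY//; apply: ae_eq_integral => //.
- exact: Gm.
- by apply: measurable_funTS; case/integrableP: iW.
- by apply: measurable_funTS; case/integrableP: i1.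
- case: E0 => N [mN N0 EN]; exists N; split => // x /= /not_implyP[Dx W1].
  by apply: EN; split => // /= W1x; apply: W1; rewrite W1x.
Qed.

End cond_exp.

(** * Negligible events on an atom of the length *)

Section bridge_events.
Context (R : realType) (PX : probability (skorohod R) R) (f : R -> R -> \bar R).
Hypotheses (hX : levy_law PX) (hf : marginal_density PX f).
Context d (T : measurableType d) (P : probability T R)
  (tau Z : {RV P >-> R}) (zeta : {RV P >-> skorohod R}).
Hypothesis hzeta : levy_bridge PX f tau Z zeta.
Variables (r : R) (Pr : P (tau @^-1` [set r]) != 0%E).

Lemma bridge_ae_admissible : {ae distribution P Z, forall z, admissible f r z}.
Proof.
have [_ ind adm _] := hzeta.
exact: (@joint_law_ae_section _ _ _ _ _ _ ind r Pr (fun v => admissible f v.1 v.2) adm).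
Qed.

Lemma bridge_event_law : exists kappa : R.-pker (R * R)%type ~> skorohod R,
  {ae distribution P Z, forall z, bridge_law PX f r z (kappa (r, z))} /\
  forall A, measurable A ->
    P (tau @^-1` [set r] `&` zeta @^-1` A) = 0%E <->
    distribution P Z [set z | kappa (r, z) A != 0%E] = 0%E.
Proof.
have [_ ind _ [kappa [rcd law]]] := hzeta.
exists kappa; split; last by move=> A mA; exact: cond_dist_null.
exact: (@joint_law_ae_section _ _ _ _ _ _ ind r Pr
  (fun v => bridge_law PX f v.1 v.2 (kappa v)) law).
Qed.

Lemma measurable_kernel_section (kappa : R.-pker (R * R)%type ~> skorohod R)
    (A : set (skorohod R)) : measurable A ->
  measurable [set z | kappa (r, z) A != 0%E].
Proof.
move=> mA; have mk := measurable_kernel kappa A mA.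
rewrite -[X in measurable X]setTI; apply: emeasurable_neq => //.
by apply: (measurableT_comp mk); exact: measurable_pair1.
Qed.

Lemma bridge_event_negligible (A : set (skorohod R)) : measurable A ->
  (forall z (Q : {measure set (skorohod R) -> \bar R}),
     bridge_law PX f r z Q -> Q A = 0%E) ->
  P.-negligible (tau @^-1` [set r] `&` zeta @^-1` A).
Proof.
move=> mA QA; have [kappa [[N [mN N0 lawN]] kappaE]] := bridge_event_law.
apply/negligibleP.
  by apply: measurableI; rewrite -[X in measurable X]setTI; exact: measurable_funPT.
apply/kappaE => //.
apply: (subset_measure0 _ mN _ N0); first exact: measurable_kernel_section.
by move=> z /= kz; apply: lawN => /= /QA; apply/eqP.
Qed.

Lemma bridge_frozen_negligible (A : set (skorohod R)) : measurable A ->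
  (forall z w, A w -> exists2 t, r <= t & coord t w <> z) ->
  P.-negligible (tau @^-1` [set r] `&` zeta @^-1` A).
Proof.
move=> mA Az; apply: bridge_event_negligible => // z Q lawQ.
exact: (bridge_frozen lawQ mA (Az z)).
Qed.

Lemma bridge_adapted_negligible (t : R) (A : set (skorohod R)) :
  0 <= t -> t < r -> natural_filtration (@coord R) t A -> PX A = 0%E ->
  P.-negligible (tau @^-1` [set r] `&` zeta @^-1` A).
Proof.
move=> t0 tr FA A0; apply: bridge_event_negligible => [|z Q lawQ].
  by apply: natural_filtration_measurable FA; exact: measurable_coord.
exact: (bridge_null hf lawQ t0 tr FA A0).
Qed.

(** From time [r] on the bridge sits at its pinning point. For almost every [z] in [B], both the
    event of being in [B] at time [t] and its complement would be null for a probability measure. *)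
Lemma pinning_point_null (t : R) (B : set R) : r <= t -> measurable B ->
  P.-negligible (tau @^-1` [set r] `&` (fun x => zeta x t) @^-1` B) ->
  distribution P Z B = 0%E.
Proof.
move=> rt mB; have mA : measurable (coord t @^-1` B).
  by rewrite -[X in measurable X]setTI; exact: measurable_coord.
have [kappa [[N [mN N0 lawN]] kappaE]] := bridge_event_law.
move/negligibleP => B0.
have {B0} /kappaE : P (tau @^-1` [set r] `&` zeta @^-1` (coord t @^-1` B)) = 0%E.
  apply: B0; apply: measurableI; rewrite -[X in measurable X]setTI.
    exact: measurable_funPT.
  by apply: (measurableT_comp (measurable_coord t)).
move=> /(_ mA) k0; have mk := measurable_kernel_section kappa mA.
apply: (@subset_measure0 _ _ _ (distribution P Z) B
  (N `|` [set z | kappa (r, z) (coord t @^-1` B) != 0%E])) => //.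
- exact: measurableU.
- move=> z Bz; apply: contrapT => /not_orP[Nz /negP]; rewrite negbK => /eqP kB.
  have lawz : bridge_law PX f r z (kappa (r, z)).
    by apply: contrapT => /lawN.
  have kC : kappa (r, z) (coord t @^-1` (~` B)) = 0%E.
    apply: (bridge_frozen lawz).
      rewrite -[X in measurable X]setTI; apply: measurable_coord => //.
      exact: measurableC.
    by move=> w /= Bw; exists t => // wz; apply: Bw; rewrite wz.
  have : kappa (r, z) setT = 0%E.
    rewrite -(setvU (coord t @^-1` B)) preimage_setC measureU0//.
    + exact: measurableC.
  by rewrite prob_kernel => /eqP; rewrite onee_eq0.
- by apply: etrans N0; exact: (@measureU0 _ _ _ (distribution P Z)).
Qed.

(** Tonelli rewrites the two-time probability as the integral over [z] in [K] of [phi z], which is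
    [f r z] times the probability that the bridge to [z] is in [K] at time [t]. Were the event
    negligible, [phi] would vanish on [K] almost everywhere for the law of [Z], hence for Lebesgue
    measure, and the integral would be 0. *)
Lemma bridge_visits (t : R) (K : set R) : 0 < t -> t < r -> measurable K ->
  (forall N, measurable N -> N `<=` K -> distribution P Z N = 0%E ->
     lebesgue_measure N = 0%E) ->
  (0 < PX (coord t @^-1` K `&` coord r @^-1` K))%E ->
  ~ P.-negligible (tau @^-1` [set r] `&` (fun x => zeta x t) @^-1` K).
Proof.
move=> t0 tr mK KZ KK; have rt : 0 < r - t by rewrite subr_gt0.
pose A := coord t @^-1` K; pose S := measurableTypeR R.
have mA : measurable A by rewrite -[X in measurable X]setTI; exact: measurable_coord.
have mAT : measurable (tau @^-1` [set r] `&` zeta @^-1` A).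
  by apply: measurableI; rewrite -[X in measurable X]setTI; exact: measurable_funPT.
have [mf f0 _] := hf rt.
pose g (v : S * skorohod R) := f (r - t) (v.1 - coord t v.2).
have mg : measurable_fun [set: S * skorohod R] g.
  apply: (measurableT_comp mf); apply: measurable_funB; first exact: measurable_fst.
  by apply: (measurableT_comp (measurable_coord t)).
have mKA : measurable ((K : set S) `*` A) by exact: measurableX.
pose F := g \_ ((K : set S) `*` A).
have mF : measurable_fun [set: S * skorohod R] F.
  by apply/(measurable_restrictT _ _).1 => //; exact: measurable_funTS.
have F0 v : (0 <= F v)%E by rewrite /F patchE; case: ifP => // _; exact: f0.
have FK z : (\int[PX]_w F (z, w) =
    (fun z => \int[PX]_(w in A) f (r - t) (z - coord t w)%R) \_ K z)%E.
  rewrite patchE; case: ifPn => zK.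
    rewrite [RHS]integral_mkcond; apply: eq_integral => w _.
    by rewrite /F !patchE in_setX zK.
  by rewrite integral0_eq// => w _; rewrite /F patchE in_setX (negbTE zK).
have FA w : (\int[lebesgue_measure]_z F (z, w) =
    (fun w => \int[lebesgue_measure]_(z in K) f (r - t) (z - coord t w)%R) \_ A w)%E.
  rewrite patchE; case: ifPn => wA.
    rewrite [RHS]integral_mkcond; apply: eq_integral => z _.
    by rewrite /F !patchE in_setX wA andbT.
  by rewrite integral0_eq// => z _; rewrite /F patchE in_setX (negbTE wA) andbF.
have := @fubini_tonelli _ _ _ _ _ (@lebesgue_measure R) PX F mF F0.
under eq_integral do rewrite FK.
under [in RHS]eq_integral do rewrite FA.
rewrite -!integral_mkcond -(prob_two_times hX hf t0 tr mK) => FT neg.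
move: KK; rewrite -FT; apply/negP; rewrite -leNgt.
set phi := fun z : R => (\int[PX]_(w in A) f (r - t) (z - coord t w)%R)%E.
have phi0 z : (0 <= phi z)%E by apply: integral_ge0 => w _; exact: f0.
have mphi : measurable_fun (K : set S) phi.
  apply/(measurable_restrictT _ mK); apply: eq_measurable_fun.
    by move=> z _; exact: FK.
  exact: measurable_fun_fubini_tonelli_F.
have mB : measurable ((K : set S) `&` [set z | phi z != 0%E]) by exact: emeasurable_neq.
have [kappa [lawE kappaE]] := bridge_event_law.
suff B0 : lebesgue_measure (K `&` [set z | phi z != 0%E]) = 0%E.
  suff -> : (\int[lebesgue_measure]_(x in K) phi x = 0)%E by [].
  by apply/ge0_integral_eq0P => // z _; exact: phi0.
apply: KZ => //.
have kA : (distribution P Z).-negligible [set z | kappa (r, z) A != 0%E].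
  apply/negligibleP; first exact: measurable_kernel_section.
  by apply/kappaE => //; apply/negligibleP.
apply/(@negligibleP _ _ _ (distribution P Z)) => //.
apply: negligibleS (negligibleU kA (negligibleU lawE bridge_ae_admissible)).
move=> z [Kz phiz].
apply: contrapT => /not_orP[/= /negP]; rewrite negbK => /eqP kA0.
move=> /not_orP[/contrapT lawz /contrapT admz]; move: phiz => /=.
rewrite /phi (bridge_eq0 hf lawz (ltW t0) tr _ admz kA0) ?eqxx//.
by apply: natural_filtration_coord => //; rewrite (ltW t0) lexx.
Qed.

End bridge_events.

(** * Two lengths against the Markov property *)

Lemma natural_filtration_eq_times (R : realType) (T : pointedType)
    (Y : R -> T -> R) (s t u : R) : 0 <= s <= u -> 0 <= t <= u ->
  natural_filtration Y u [set x | Y s x = Y t x].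
Proof.
move=> su tu; pose U := g_sigma_algebraType
  (\bigcup_(s in [set s : R | 0 <= s <= u]) g_sigma_algebra_preimage (Y s)).
have mY v : 0 <= v <= u -> measurable_fun [set: U] (Y v : U -> R).
  by move=> vu _ B mB; rewrite setTI; exact: natural_filtration_coord.
have : measurable_fun [set: U] ((Y s : U -> R) \- Y t).
  by apply: measurable_funB; exact: mY.
move=> /(_ measurableT [set 0] (measurable_set1 _)); rewrite setTI.
rewrite (_ : _ @^-1` _ = [set x | Y s x = Y t x])//.
by apply/seteqP; split=> x /=; [move/subr0_eq|move=> ->; rewrite subrr].
Qed.

Lemma natural_filtrationI (R : realType) (T : pointedType)
    (Y : R -> T -> R) (t : R) : setI_closed (natural_filtration Y t).
Proof.
move=> A B; exact: (@measurableI _ (g_sigma_algebraType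
  (\bigcup_(s in [set s : R | 0 <= s <= t]) g_sigma_algebra_preimage (Y s)))).
Qed.

Lemma natural_filtrationC (R : realType) (T : pointedType)
    (Y : R -> T -> R) (t : R) (A : set T) :
  natural_filtration Y t A -> natural_filtration Y t (~` A).
Proof.
exact: (@measurableC _ (g_sigma_algebraType
  (\bigcup_(s in [set s : R | 0 <= s <= t]) g_sigma_algebra_preimage (Y s)))).
Qed.

Section two_lengths.
Context (R : realType) (PX : probability (skorohod R) R) (f : R -> R -> \bar R).
Hypotheses (hX : levy_law PX) (hf : marginal_density PX f).
Context d (T : measurableType d) (P : probability T R)
  (tau Z : {RV P >-> R}) (zeta : {RV P >-> skorohod R}).
Hypothesis hzeta : levy_bridge PX f tau Z zeta.
Variables (r1 r2 : R) (r1_gt0 : 0 < r1).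
Hypotheses (Pr1 : P (tau @^-1` [set r1]) != 0%E)
  (Pr2 : P (tau @^-1` [set r2]) != 0%E)
  (tau12 : forall x, tau x = r1 \/ tau x = r2).
Variables (K : set R) (mK : measurable K).
Hypothesis KZ : forall N, measurable N -> N `<=` K ->
  distribution P Z N = 0%E -> lebesgue_measure N = 0%E.
Variables (t u : R) (r1t : r1 < t) (tu : t < u) (ur2 : u < r2).

Local Notation Y := (fun t x => zeta x t).
Local Notation T1 := (tau @^-1` [set r1]).
Local Notation T2 := (tau @^-1` [set r2]).

Let t_ge0 : 0 <= t. Proof. by rewrite ltW// (lt_trans r1_gt0). Qed.

Let measurable_Y s : measurable_fun [set: T] (Y s).
Proof. exact: (measurableT_comp (measurable_coord s)). Qed.

Let T1_frozen a b : r1 <= a -> r1 <= b ->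
  P.-negligible (T1 `&` [set x | Y a x <> Y b x]).
Proof.
move=> ra rb; have -> : [set x | Y a x <> Y b x] =
    zeta @^-1` [set w | coord a w <> coord b w] by [].
apply: (bridge_frozen_negligible hzeta Pr1).
  rewrite (_ : mkset _ = ~` [set w | coord a w = coord b w]); last by [].
  apply: measurableC; pose c := Num.max a b.
  apply: (@natural_filtration_measurable _ _ _ (@coord R) c).
    exact: measurable_coord.
  have a0 := le_trans (ltW r1_gt0) ra; have b0 := le_trans (ltW r1_gt0) rb.
  by apply: natural_filtration_eq_times; rewrite ?a0 ?b0 /c le_max lexx ?orbT.
move=> z w /= ab; have [az|az] := pselect (coord a w = z); [exists b|exists a] => //.
by move=> bz; apply: ab; rewrite az bz.
Qed.

Let T2_moving a b : 0 <= a -> a < b -> b < r2 ->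
  P.-negligible (T2 `&` [set x | Y a x = Y b x]).
Proof.
move=> a0 ab br; apply: (bridge_adapted_negligible hf hzeta Pr2
  (t := b) (A := [set w | coord a w = coord b w])) => //.
- by rewrite (le_trans a0)// ltW.
- by apply: natural_filtration_eq_times; rewrite ?a0 ?lexx ?andbT ?ltW// (le_lt_trans a0).
- exact: (coord_eq_null hX hf).
Qed.

Let T2_diffuse N : measurable N -> lebesgue_measure N = 0%E ->
  P.-negligible (T2 `&` Y t @^-1` N).
Proof.
move=> mN N0; apply: (bridge_adapted_negligible hf hzeta Pr2
  (t := t) (A := coord t @^-1` N)) => //.
- exact: lt_trans ur2.
- by apply: natural_filtration_coord => //; rewrite t_ge0 lexx.
- by apply: (marginal_abs_continuous hf) => //; exact: lt_trans r1t.
Qed.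

Hypothesis markovY : markov_property P (fun t x => zeta x t).

(* By [cond_exp_const1] the prediction of zeta_u in A is 1 on {tau = r1, zeta_t in A};
   being a function of zeta_t it is 1 on {tau = r2, zeta_t in K, zeta_t in A} too. *)
Let markov_constant (A : set R) : measurable A ->
  P.-negligible (T2 `&` [set x | [/\ K (Y t x), A (Y t x) & ~ A (Y u x)]]).
Proof.
move=> mA; pose g : R -> R := \1_A.
have mg : measurable_fun [set: R] g by exact: measurable_indic.
have gle1 x : g x <= 1 by rewrite /g indicE; case: (_ \in _).
have gE x : g x <> 1 <-> ~ A x.
  rewrite /g indicE; case: (boolP (x \in A)) => [/set_mem|/negP].
    by split=> // /(_ erefl).
  by rewrite inE => nA; split=> // _ /esym/eqP; rewrite oner_eq0.
have gbound : exists M : R, forall x, `|g x| <= M.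
  by exists 1 => x; rewrite ger0_norm ?gle1// /g indicE; case: (_ \in _).
have [W1 [W2 [YW1 YW2 W12]]] := markovY t_ge0 tu mg gbound.
have Fm : natural_filtration Y t `<=` measurable.
  by move=> C; apply: natural_filtration_measurable; exact: measurable_Y.
have FI := @natural_filtrationI _ _ Y t.
have igY : P.-integrable [set: T] (EFin \o (fun x => g (Y u x))).
  apply: measurable_bounded_integrable => //.
  - by rewrite (le_lt_trans (probability_le1 _ _))// ltry.
  - exact: (measurableT_comp mg (measurable_Y u)).
  - case: gbound => M gM; exists M; split; first exact: num_real.
    by move=> x /ltW Mx y _ /=; exact: le_trans (gM _) Mx.
have r1tt : 0 <= r1 <= t by rewrite !ltW.
have ttt : 0 <= t <= t by rewrite t_ge0 lexx.
have Feq := natural_filtration_eq_times (Y := Y) r1tt ttt.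
have Fcoord (C : set R) : measurable C -> natural_filtration Y t (Y t @^-1` C).
  by move=> mC; exact: natural_filtration_coord.
have rt : r1 <= t by exact: ltW.
have ru : r1 <= u by rewrite ltW// (lt_trans r1t).
have neg1 := T1_frozen (lexx r1) rt.
have neg2 := T2_moving (ltW r1_gt0) r1t (lt_trans tu ur2).
(* Up to a negligible set this is the event [tau = r1] with [Y t] in [A], but expressed by the past
   of [zeta] alone, so that it lies in the natural filtration. *)
pose E1 := [set x | Y r1 x = Y t x] `&` Y t @^-1` A.
have FE1 : natural_filtration Y t E1 by apply: FI => //; exact: Fcoord.
have E1W1 : P.-negligible (E1 `&` [set x | W1 x <> 1]).
  apply: (cond_exp_const1 Fm FI igY YW1 FE1).
  apply: negligibleS (negligibleU (T1_frozen rt ru) neg2) => x [[/= rtx Ax] /gE uA].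
  have [tx|tx] := tau12 x; [left|right] => //; split => //= tux.
  by apply: uA; rewrite -tux.
have E1W2 : P.-negligible (E1 `&` [set x | W2 x <> 1]).
  apply: negligibleS (negligibleU E1W1 W12) => x [E1x /= W2x].
  by have [W12x|W12x] := pselect (W1 x = W2 x); [left; rewrite -W12x in W2x|right].
(* Here the Markov property enters: [W2] depends on [Y t] only, so the failure of [W2 = 1] is a
   condition on the value of [Y t], whatever the length. *)
have [B mB W2B] : exists2 B : set R, measurable B &
    Y t @^-1` B = [set x | W2 x <> 1].
  have [/(_ (~` [set 1]) (measurableC (measurable_set1 _))) [B mB] ] := YW2.
  by rewrite setTI => BE _ _; exists B.
(* On [tau = r1] the value [Y t] is the pinning point, and there [W2] is 1 once [Y t] is in [A]. *)
have PZ0 : distribution P Z (A `&` B) = 0%E.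
  apply: (pinning_point_null hzeta Pr1 rt); first exact: measurableI.
  apply: negligibleS (negligibleU neg1 E1W2) => x [/= tx [Ax Bx]].
  have [rtx|rtx] := pselect (Y r1 x = Y t x); [right|by left].
  by split=> //; rewrite -[W2 x <> 1]/([set x | W2 x <> 1] x) -W2B.
(* The choice of [K] passes from the law of [Z] to Lebesgue measure; [T2_diffuse] then passes to the
   law of [Y t] on [tau = r2]. *)
have KAB0 : lebesgue_measure (K `&` (A `&` B)) = 0%E.
  apply: KZ; [by apply: measurableI => //; exact: measurableI|by move=> x []|].
  apply: (@subset_measure0 _ _ _ (distribution P Z) _ (A `&` B)) => //;
    last exact: measurableI.
  by apply: measurableI => //; exact: measurableI.
have mKAB : measurable (K `&` (A `&` B)) by apply: measurableI => //; exact: measurableI.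
(* The counterpart of [E1] for [tau = r2], again an event of the past up to negligible sets. *)
pose E2 := ~` [set x | Y r1 x = Y t x] `&` Y t @^-1` (K `&` A).
have FE2 : natural_filtration Y t E2.
  by apply: FI; [exact: natural_filtrationC|apply: Fcoord; exact: measurableI].
have E2W1 : P.-negligible (E2 `&` [set x | W1 x <> 1]).
  apply: negligibleS (negligibleU W12 (negligibleU neg1 (T2_diffuse mKAB KAB0))).
  move=> x [[/= rtx [Kx Ax]] W1x].
  have [W12x|W12x] := pselect (W1 x = W2 x); [right|by left].
  have [tx|tx] := tau12 x; [by left|right]; split => //; split => //; split => //.
  by rewrite -[B _]/((Y t @^-1` B) x) W2B /= -W12x.
have E2Y := cond_exp_const1_converse Fm igY YW1 FE2 (fun x => gle1 (Y u x)) E2W1.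
apply: negligibleS (negligibleU E2Y neg2) => x [/= tx [Kx Ax uA]].
have [rtx|rtx] := pselect (Y r1 x = Y t x); [by right|left].
by split => //; apply/gE.
Qed.

(** If [Y t] and [Y u] differ, a rational separates them, and one of the two half-lines at that
    rational contains [Y t] but not [Y u]. So [markov_constant] for countably many half-lines forces
    [Y t = Y u], which [T2_moving] excludes. *)
Lemma two_lengths_avoid : P.-negligible (T2 `&` Y t @^-1` K).
Proof.
pose N (A : set R) := T2 `&` [set x | [/\ K (Y t x), A (Y t x) & ~ A (Y u x)]].
pose F n := if unpickle n is Some q then
  N `]-oo, ratr q[%classic `|` N `[ratr q, +oo[%classic else set0.
have FE q : F (pickle q) = N `]-oo, ratr q[%classic `|` N `[ratr q, +oo[%classic.
  by rewrite /F pickleK.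
have negF : P.-negligible (\bigcup_n F n).
  apply: negligible_bigcup => n; rewrite /F; case: unpickle => [q|].
    by apply: negligibleU; apply: markov_constant; exact: measurable_itv.
  exact: negligible_set0.
have neg := T2_moving t_ge0 tu ur2.
apply: negligibleS (negligibleU neg negF) => x [/= tx Kx].
case: (ltgtP (Y t x) (Y u x)) => [tux|utx|/= tux]; last by left.
- have [q] := rat_in_itvoo tux; rewrite in_itv/= => /andP[tq qu]; right;
   exists (pickle q); first exact: I.
  rewrite FE; left; split; [exact: tx|split; [exact: Kx| |]]; rewrite /= in_itv//=.
  by rewrite ltNge ltW.
- have [q] := rat_in_itvoo utx; rewrite in_itv/= => /andP[uq qt]; right;
   exists (pickle q); first exact: I.
  rewrite FE; right; split; [exact: tx|split; [exact: Kx| |]]; rewrite /= in_itv/= andbT.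
    exact: ltW.
  by rewrite leNgt uq.
Qed.

End two_lengths.

Lemma two_lengths_not_markov (R : realType) (PX : probability (skorohod R) R)
    (f : R -> R -> \bar R) (hX : levy_law PX) (hf : marginal_density PX f)
    d (T : measurableType d) (P : probability T R) (tau Z : {RV P >-> R})
    (zeta : {RV P >-> skorohod R}) (r1 r2 : R) (K : set R) :
  levy_bridge PX f tau Z zeta -> 0 < r1 -> r1 < r2 ->
  P (tau @^-1` [set r1]) != 0%E -> P (tau @^-1` [set r2]) != 0%E ->
  (forall x, tau x = r1 \/ tau x = r2) ->
  compact K -> (0 < lebesgue_measure K)%E ->
  (forall N, measurable N -> N `<=` K -> distribution P Z N = 0%E ->
     lebesgue_measure N = 0%E) ->
  ~ markov_property P (fun t x => zeta x t).
Proof.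
move=> hzeta r10 r12 P1 P2 tau12 cK K0 KZ mkv.
have mK := compact_measurable cK; have r20 := lt_trans r10 r12.
have [mf f0 fE] := hf _ r20.
(* Admissibility makes [f r2] nonzero almost everywhere for the law of [Z], hence Lebesgue-almost
   everywhere on [K]. *)
have XK : (0 < PX (coord r2 @^-1` K))%E.
  rewrite lt0e measure_ge0 andbT; apply/eqP; rewrite fE// => int0.
  have : lebesgue_measure (K `&` [set x | f r2 x != 0%E]) = 0%E.
    by apply/ge0_integral_eq0P => //; exact: measurable_funTS.
  have mN : measurable (K `&` [set x | f r2 x = 0%E]).
    have mfK : measurable_fun K (f r2) by exact: measurable_funTS.
    exact: (mfK mK [set 0%E] (emeasurable_set1 _)).
  have : lebesgue_measure (K `&` [set x | f r2 x = 0%E]) = 0%E.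
    apply: KZ => //; apply/(@negligibleP _ _ _ (distribution P Z)) => //.
    apply: negligibleS (bridge_ae_admissible hzeta P2) => x [_ /= fx0].
    by rewrite /admissible fx0 ltxx.
  move=> /(@negligibleP _ _ _ (@lebesgue_measure R) _ mN) neg0.
  have mN' : measurable (K `&` [set x | f r2 x != 0%E]).
    by apply: emeasurable_neq => //; exact: measurable_funTS.
  move=> /(@negligibleP _ _ _ (@lebesgue_measure R) _ mN') neg1.
  have : (@lebesgue_measure R).-negligible K.
    apply: negligibleS (negligibleU neg0 neg1) => x Kx.
    by have [fx|/eqP fx] := pselect (f r2 x = 0%E); [left|right].
  by move=> /(@negligibleP _ _ _ (@lebesgue_measure R) _ mK) /eqP; rewrite gt_eqF.
have [t /andP[r1t tr2] KK] := prob_two_times_gt0 hX hf r10 r12 cK XK.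
pose u := (t + r2) / 2.
have tu : t < u by rewrite /u; lra.
have ur2 : u < r2 by rewrite /u; lra.
have avoid := two_lengths_avoid hX hf hzeta r10 P1 P2 tau12 mK KZ r1t tu ur2 mkv.
exact: (bridge_visits hX hf hzeta P2 (lt_trans r10 r1t) tr2 mK KZ KK avoid).
Qed.

Lemma measurable_inve_pos d (T : measurableType d) (R : realType) (D : set T)
    (g : T -> \bar R) : measurable D -> measurable_fun D g ->
  (forall x, D x -> (0 < g x < +oo)%E) ->
  measurable_fun D (fun x => (g x)^-1)%E.
Proof.
move=> mD mg g0.
have gfin x : D x -> 0 < fine (g x) /\ g x = (fine (g x))%:E.
  by move=> /g0/andP[gx0 gxoo]; rewrite fine_gt0 ?gx0// fineK// ge0_fin_numE ?ltW.
apply: (@eq_measurable_fun _ _ _ _ D (fun x => ((fine (g x))^-1)%:E)).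
  move=> x /set_mem /gfin[gx0 gxE]; rewrite [in RHS]gxE inver.
  by rewrite gt_eqF.
apply/measurable_EFinP.
apply: (@measurable_comp _ _ _ _ _ _ [set r : R | r != 0%R]) => //.
- exact: open_measurable.
- by move=> _ [x Dx <-] /=; have [gx0 _] := gfin x Dx; rewrite gt_eqF.
- apply: open_continuous_measurable_fun => //; apply/in_setP => x /= x0.
  exact: inv_continuous.
- exact: measurableT_comp.
Qed.

(** * Existence of the bridge *)

Lemma eq_measure_off_null d (T : measurableType d) (R : realType)
    (mu : {measure set T -> \bar R}) (A B N : set T) :
  measurable A -> measurable B -> measurable N -> mu N = 0%E ->
  A `\` N = B `\` N -> mu A = mu B.
Proof.
move=> mA mB mN N0 AB; rewrite -(measureU0 mA mN N0) -(measureU0 mB mN N0).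
congr (mu _); apply/seteqP; split=> x [ABx|]; try by right.
  have [Nx|Nx] := pselect (N x); [by right|left].
  by have : (A `\` N) x by []; rewrite AB => -[].
have [Nx|Nx] := pselect (N x); [by right|left].
by have : (B `\` N) x by []; rewrite -AB => -[].
Qed.

Section bridge_kernel.
Context (R : realType) (PX : probability (skorohod R) R) (f : R -> R -> \bar R).
Hypothesis hf : marginal_density PX f.
Variables (r : R) (r_gt0 : 0 < r) (Q : R -> probability (skorohod R) R).
Hypothesis hQ : forall z, admissible f r z -> bridge_law PX f r z (Q z).

Local Notation D := [set z | admissible f r z].

(* A pi-system generating the cylinder sigma-algebra: up to paths that are not
   frozen from time r on, its events split into a part known before time r and a
   condition on the pinning point. *)
Definition bridge_rectangle : set (set (skorohod R)) :=
  [set E | measurable E /\ exists t A B,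
    [/\ 0 <= t < r, natural_filtration (@coord R) t A, measurable B &
      forall w, (forall s, r <= s -> coord s w = coord r w) ->
        E w <-> A w /\ B (coord r w)]].

Lemma measurable_admissible : measurable D.
Proof.
have [mf _ _] := hf r_gt0.
have -> : D = [set z | (0 < f r z)%E] `&` [set z | (f r z < +oo)%E].
  by apply/seteqP; split=> z; rewrite /admissible/= => /andP.
by apply: measurableI; rewrite -[X in measurable X]setTI;
  [exact: emeasurable_fun_o_infty|exact: emeasurable_fun_infty_o].
Qed.

Lemma bridge_rectangleI : setI_closed bridge_rectangle.
Proof.
move=> E E' [mE [t [A [B [/andP[t0 tr] FA mB EAB]]]]].
move=> [mE' [t' [A' [B' [/andP[t'0 t'r] FA' mB' EAB']]]]].
split; first exact: measurableI.
exists (Num.max t t'), (A `&` A'), (B `&` B'); split.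
- by rewrite le_max t0/= gt_max tr t'r.
- apply: natural_filtrationI.
  + by apply: natural_filtration_le FA; rewrite le_max lexx.
  + by apply: natural_filtration_le FA'; rewrite le_max lexx orbT.
- exact: measurableI.
- move=> w wr; have {}EAB := EAB w wr; have {}EAB' := EAB' w wr.
  by split=> [[/EAB[? ?] /EAB'[? ?]]|[[? ?] [? ?]]]; split; [| |apply/EAB|apply/EAB'].
Qed.

(** A coordinate before time [r] gives a condition on the past; on a path frozen from [r] on, a
    later coordinate is the one at [r] and gives a condition on the pinning point. *)
Lemma measurable_bridge_rectangle :
  @measurable _ (skorohod R) = <<s bridge_rectangle >>.
Proof.
apply/seteqP; split; last first.
  by apply: smallest_sub => [|E []//]; exact: sigma_algebra_measurable.
apply: smallest_sub; first exact: smallest_sigma_algebra.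
move=> _ [s /= s0 [B mB <-]]; apply: sub_sigma_algebra; split.
  exact: measurable_coord.
have [sr|rs] := ltP s r.
  exists s, (coord s @^-1` B), setT; split => //.
  - by rewrite s0.
  - by apply: natural_filtration_coord; rewrite ?s0 ?lexx.
  - by move=> w _; split=> [[]|[]].
exists 0, setT, B; split => //.
- by rewrite lexx.
- exact: (@measurableT _ (g_sigma_algebraType
    (\bigcup_(s in [set s : R | 0 <= s <= 0]) g_sigma_algebra_preimage (@coord R s)))).
- by move=> w wr; rewrite -(wr s rs); split=> [[_]|[]].
Qed.

(** The change of measure makes [Q z A] an integral depending on the parameter [z], measurable by
    Tonelli, divided by [f r z]. *)
Lemma measurable_bridge_adapted (t : R) (A : set (skorohod R)) :
  0 <= t -> t < r -> natural_filtration (@coord R) t A ->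
  measurable_fun D (fun z => Q z A).
Proof.
move=> t0 tr FA; have rt : 0 < r - t by rewrite subr_gt0.
have mA : measurable A.
  by apply: natural_filtration_measurable FA; exact: measurable_coord.
have mD := measurable_admissible.
have [mf f0 _] := hf rt; have [mfr _ _] := hf r_gt0.
apply: (@eq_measurable_fun _ _ _ _ D (fun z =>
    (\int[PX]_(w in A) f (r - t) (z - coord t w)%R) * (f r z)^-1)%E).
  move=> z /set_mem Dz; have [/(_ t A t0 tr FA) -> _] := hQ Dz.
  rewrite ge0_integralZr//.
  - by apply: measurable_funTS; exact: (measurable_bridge_density hf).
  - by rewrite inve_ge0 ltW//; case/andP: Dz.
apply: emeasurable_funM; last first.
  by apply: measurable_inve_pos => //; exact: measurable_funTS.
apply: measurable_funTS.
pose g (v : R * skorohod R) := f (r - t) (v.1 - coord t v.2).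
have mg : measurable_fun [set: R * skorohod R] g.
  apply: (measurableT_comp mf); apply: measurable_funB; first exact: measurable_fst.
  by apply: (measurableT_comp (measurable_coord t)).
pose F := g \_ ([set: R] `*` A).
have mF : measurable_fun [set: R * skorohod R] F.
  apply/(measurable_restrictT _ _).1; last exact: measurable_funTS.
  exact: measurableX.
have F0 v : (0 <= F v)%E by rewrite /F patchE; case: ifP => // _; exact: f0.
apply: (@eq_measurable_fun _ _ _ _ setT (fun z => \int[PX]_w F (z, w))%E).
  move=> z _; rewrite [RHS]integral_mkcond; apply: eq_integral => w _.
  by rewrite /F !patchE in_setX in_setT.
exact: measurable_fun_fubini_tonelli_F.
Qed.

(** The bridge laws form a kernel however they were selected, because [bridge_law] fixes their
    values on a generating pi-system; a Dynkin argument extends measurability from there. *)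
Lemma measurable_bridge_law (E : set (skorohod R)) :
  measurable E -> measurable_fun D (fun z => Q z E).
Proof.
have mD := measurable_admissible.
rewrite measurable_bridge_rectangle => SE.
apply: (dynkin_induction (P := fun E => measurable_fun D (fun z => Q z E))
  measurable_bridge_rectangle bridge_rectangleI _ _ _ _ SE).
- apply: (@eq_measurable_fun _ _ _ _ D (cst 1%E)); last exact: measurable_cst.
  by move=> z _; rewrite probability_setT.
- move=> C [mC [t [A [B [/andP[t0 tr] FA mB CAB]]]]].
  have mA : measurable A.
    by apply: natural_filtration_measurable FA; exact: measurable_coord.
  (* Almost every path of the bridge is frozen at [z], so the condition on the pinning point becomes
     the indicator of [B] at [z]. *)
  apply: (@eq_measurable_fun _ _ _ _ D (fun z => Q z A * (\1_B z)%:E)%E).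
    move=> z /set_mem /hQ [_ [N [mN N0 Nz]]].
    have wz w : ~ N w -> forall s, r <= s -> coord s w = z.
      by move=> Nw; apply: contrapT => /Nz.
    rewrite indicE; have [zB|zB] := boolP (z \in B).
      rewrite mule1; apply: (eq_measure_off_null mA mC mN N0).
      apply/seteqP; split=> w [Aw Nw]; split=> //.
        apply/CAB; first by move=> s rs; rewrite !(wz w Nw).
        by rewrite (wz w Nw)//; split=> //; exact: set_mem.
      by have [|+ _] := (CAB w _).1 Aw; first by move=> s rs; rewrite !(wz w Nw).
    rewrite mule0; apply/esym/(subset_measure0 mC mN _ N0) => w Cw.
    apply: contrapT => Nw; have [|_] := (CAB w _).1 Cw.
      by move=> s rs; rewrite !(wz w Nw).
    by rewrite (wz w Nw)// => /mem_set; apply/negP.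
  apply: emeasurable_funM; first exact: measurable_bridge_adapted FA.
  by apply: measurable_funTS; apply/measurable_EFinP; exact: measurable_indic.
- move=> C mC QC; apply: (@eq_measurable_fun _ _ _ _ D (fun z => 1 - Q z C)%E).
    by move=> z _; rewrite probability_setC.
  by apply: emeasurable_funB => //; exact: measurable_cst.
- move=> F mF tF QF.
  apply: (@eq_measurable_fun _ _ _ _ D
    (fun z => \sum_(i <oo | i \in [set: nat]) Q z (F i))%E).
    by move=> z _; rewrite measure_bigcup.
  exact: ge0_emeasurable_sum.
Qed.

End bridge_kernel.

(** * The kernel of bridges and the enlarged space for two lengths *)

Section kernel_patch.
Context d d' (X : measurableType d) (T : measurableType d') (R : realType).
Variables (D : set X) (Q : X -> probability T R) (k : R.-pker X ~> T).
Hypotheses (mD : measurable D)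
  (mQ : forall U, measurable U -> measurable_fun D (fun x => Q x U)).

Definition kernel_patch (x : X) : {measure set T -> \bar R} :=
  let _ := (mD, mQ) in
  if x \in D then (Q x : {measure set T -> \bar R}) else k x.

Let kernel_patchE x U : kernel_patch x U = if x \in D then Q x U else k x U.
Proof. by rewrite /kernel_patch; case: ifP. Qed.

Let measurable_kernel_patch U : measurable U ->
  measurable_fun [set: X] (kernel_patch ^~ U).
Proof.
move=> mU; under eq_fun do rewrite kernel_patchE.
have DE : (fun x => x \in D) @^-1` [set true] = D.
  by apply/seteqP; split=> x /=; [exact: set_mem|exact: mem_set].
apply: measurable_fun_if => //.
- by apply: (measurable_fun_bool true); rewrite setTI DE.
- by rewrite setTI DE; exact: mQ.
- by apply: measurable_funTS; exact: measurable_kernel.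
Qed.

HB.instance Definition _ :=
  isKernel.Build _ _ _ _ _ kernel_patch measurable_kernel_patch.

Let kernel_patch_prob x : kernel_patch x [set: T] = 1%E.
Proof.
by rewrite kernel_patchE; case: ifP; rewrite ?probability_setT ?prob_kernel.
Qed.

HB.instance Definition _ :=
  Kernel_isProbability.Build _ _ _ _ _ kernel_patch kernel_patch_prob.

End kernel_patch.

(** Bridge laws are picked by choice for each [z] and overwrite [k] on the admissible part of the
    slice of length [r]. The second clause allows the step to be repeated for another length without
    spoiling the first. *)
Lemma add_bridge_kernel (R : realType) (PX : probability (skorohod R) R)
    (f : R -> R -> \bar R) (hf : marginal_density PX f) (r : R) (r_gt0 : 0 < r)
    (hbridge : forall z, admissible f r z ->
       exists Q : probability (skorohod R) R, bridge_law PX f r z Q)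
    (k : R.-pker (R * R)%type ~> skorohod R) :
  exists k' : R.-pker (R * R)%type ~> skorohod R,
    (forall z, admissible f r z -> bridge_law PX f r z (k' (r, z))) /\
    (forall v, v.1 <> r -> k' v = k v :> {measure set skorohod R -> \bar R}).
Proof.
have [Q hQ] : exists Q : R -> probability (skorohod R) R,
    forall z, admissible f r z -> bridge_law PX f r z (Q z).
  suff /choice[Q hQ] : forall z, exists Q' : probability (skorohod R) R,
    admissible f r z -> bridge_law PX f r z Q' by exists Q.
  move=> z; have [/hbridge[Q' Q'z]|nz] := pselect (admissible f r z).
    by exists Q'.
  (* A default value at the points that are not admissible. *)
  by exists PX.
pose D : set (R * R) := [set r] `*` [set z | admissible f r z].
have mDr := measurable_admissible hf r_gt0.
have mD : measurable D by exact: measurableX.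
have mQ U : measurable U -> measurable_fun D (fun v => Q v.2 U).
  move=> mU; apply: (@measurable_comp _ _ _ _ _ _ [set z | admissible f r z]
    (fun z => Q z U)) => //.
  - by move=> _ [v [_ /= vD] <-].
  - exact: (measurable_bridge_law hf r_gt0 hQ).
  - by apply: measurable_funTS; exact: measurable_snd.
exists (kernel_patch k mD mQ); split=> [z zD|v vr].
  by rewrite /= /kernel_patch mem_set//; exact: hQ.
by rewrite /= /kernel_patch memNset// => -[].
Qed.

Lemma two_lengths_kernel (R : realType) (PX : probability (skorohod R) R)
    (f : R -> R -> \bar R) (hf : marginal_density PX f) (r1 r2 : R)
    (hbridge : forall r z, 0 < r -> admissible f r z ->
       exists Q : probability (skorohod R) R, bridge_law PX f r z Q) :
  0 < r1 -> r1 < r2 ->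
  exists k : R.-pker (R * R)%type ~> skorohod R,
    (forall z, admissible f r1 z -> bridge_law PX f r1 z (k (r1, z))) /\
    (forall z, admissible f r2 z -> bridge_law PX f r2 z (k (r2, z))).
Proof.
move=> r10 r12; have r20 := lt_trans r10 r12.
have mPX : measurable_fun [set: R * R]
    (fun _ : R * R => PX : pprobability (skorohod R) R) by exact: measurable_cst.
have [k1 [k1E _]] := add_bridge_kernel hf r10 (fun z => hbridge r1 z r10)
  (kprobability mPX).
have [k2 [k2E k21]] := add_bridge_kernel hf r20 (fun z => hbridge r2 z r20) k1.
exists k2; split=> // z z1; rewrite k21/=; first exact: k1E.
by move=> r12E; rewrite r12E ltxx in r12.
Qed.

(** The space is the product of [Omega], a fair coin and path space, then completed. The coin picks
    [tau] independently of [Z], and the path [zeta] is drawn from [k] at [(tau, Z)]. *)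
Lemma two_lengths_space (R : realType) d (Omega : measurableType d)
    (P : probability Omega R) (Z : {RV P >-> R}) (r1 r2 : R)
    (k : R.-pker (R * R)%type ~> skorohod R) : r1 < r2 ->
  exists (d' : measure_display) (Omega' : measurableType d')
    (P' : probability Omega' R) (p : Omega' -> Omega)
    (tau Z' : {RV P' >-> R}) (zeta : {RV P' >-> skorohod R}),
    [/\ measure_is_complete P', space_extension P P' p, forall x, Z' x = Z (p x),
        [/\ forall x, tau x = r1 \/ tau x = r2,
            P' (tau @^-1` [set r1]) != 0%E & P' (tau @^-1` [set r2]) != 0%E]
      & indep_rv P' tau Z' /\
        regular_cond_dist P' (fun x => (tau x, Z' x)) zeta k].
Proof.
move=> r12; pose b : probability bool R := bernoulli_prob (2^-1).
have b_neq0 c : b [set c] != 0%E.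
  have h : 0 <= (2^-1 : R) <= 1 by apply/andP; split; lra.
  rewrite /b /= /bernoulli_prob h fsbig_set1 /bernoulli_pmf eqe.
  by case: c; apply/eqP => ?; lra.
have mb : measurable_fun [set: Omega] (fun _ : Omega => b : pprobability bool R).
  exact: measurable_cst.
have [P0 P0E] := joint_probability P (kprobability mb).
have {}P0E A B : measurable A -> measurable B -> (P0 (A `*` B) = P A * b B)%E.
  by move=> mA mB; rewrite P0E// integral_cst// muleC.
pose tau0 (x : Omega * bool) : R := if x.2 then r1 else r2.
have mtau0 : measurable_fun setT tau0.
  by apply: measurable_fun_ifT => //; exact: measurable_snd.
pose tauZ0 x := (tau0 x, Z x.1).
have mtauZ0 : measurable_fun setT tauZ0.
  by apply: measurable_fun_pair => //; exact: measurableT_comp.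
have [P1 P1E] := joint_probability P0 (kernel_comap k mtauZ0).
have [d' [T' [P' [q [cP' [mq qE]]]]]] := probability_completion P1.
have mq1 : measurable_fun setT (fst \o q) by exact: measurableT_comp.
have qE1 A : measurable A -> P' ((fst \o q) @^-1` A) = P0 A.
  move=> mA; have -> : (fst \o q) @^-1` A = q @^-1` (A `*` setT).
    by apply/seteqP; split=> x //= [].
  rewrite qE ?P1E//; last exact: measurableX.
  by under eq_integral do rewrite prob_kernel; rewrite integral_cst// mul1e.
have mp : measurable_fun setT (fst \o (fst \o q)) by exact: measurableT_comp.
have mtau : measurable_fun setT (tau0 \o (fst \o q)) by exact: measurableT_comp.
have mZ' : measurable_fun setT (Z \o (fst \o (fst \o q))) by exact: measurableT_comp.
have mzeta : measurable_fun setT (snd \o q) by exact: measurableT_comp.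
pose tau : {RV P' >-> R} := HB.pack (tau0 \o (fst \o q))
  (isMeasurableFun.Build _ _ _ _ _ mtau).
pose Z' : {RV P' >-> R} := HB.pack (Z \o (fst \o (fst \o q)))
  (isMeasurableFun.Build _ _ _ _ _ mZ').
pose zeta : {RV P' >-> skorohod R} := HB.pack (snd \o q)
  (isMeasurableFun.Build _ _ _ _ _ mzeta).
have mpre d1 d2 (S1 : measurableType d1) (S2 : measurableType d2) (g : S1 -> S2) B :
    measurable_fun setT g -> measurable B -> measurable (g @^-1` B).
  by move=> mg mB; rewrite -[X in measurable X]setTI; exact: mg.
have Ptau A : measurable A -> P' (tau @^-1` A) =
    b ((fun c : bool => if c then r1 else r2) @^-1` A).
  move=> mA; rewrite -[tau @^-1` A]/((fst \o q) @^-1` (tau0 @^-1` A)).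
  rewrite qE1; last exact: mpre.
  have -> : tau0 @^-1` A = setT `*` ((fun c : bool => if c then r1 else r2) @^-1` A).
    by apply/seteqP; split=> x //= [].
  by rewrite P0E// probability_setT mul1e.
have PZ' A : measurable A -> P' (Z' @^-1` A) = P (Z @^-1` A).
  move=> mA; rewrite -[Z' @^-1` A]/((fst \o q) @^-1` (fst @^-1` (Z @^-1` A))).
  have mZA : measurable (Z @^-1` A) by exact: mpre.
  rewrite qE1; last exact: mpre.
  have -> : fst @^-1` (Z @^-1` A) = (Z @^-1` A) `*` [set: bool].
    by apply/seteqP; split=> x //= [].
  by rewrite P0E// probability_setT mule1.
exists d', T', P', (fst \o (fst \o q)), tau, Z', zeta; split => //.
- split=> // A mA.
  rewrite -[_ @^-1` A]/((fst \o q) @^-1` (fst @^-1` A)) qE1; last exact: mpre.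
  have -> : fst @^-1` A = A `*` [set: bool] by apply/seteqP; split=> x //= [].
  by rewrite P0E// probability_setT mule1.
- split.
  + by move=> x; rewrite /tau /= /tau0; case: ifP; [left|right].
  + rewrite Ptau// (_ : _ @^-1` _ = [set true])//; apply/seteqP; split=> -[]//= /eqP.
    by rewrite gt_eqF.
  + rewrite Ptau// (_ : _ @^-1` _ = [set false])//; apply/seteqP; split=> -[]//= /eqP.
    by rewrite lt_eqF.
split=> [A B mA mB|C A mC mA].
  have mZB : measurable (Z @^-1` B) by exact: mpre.
  rewrite Ptau// PZ'// -[tau @^-1` A `&` _]/((fst \o q) @^-1`
    (tau0 @^-1` A `&` fst @^-1` (Z @^-1` B))).
  rewrite qE1; last by apply: measurableI; exact: mpre.
  have -> : tau0 @^-1` A `&` fst @^-1` (Z @^-1` B) =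
      (Z @^-1` B) `*` ((fun c : bool => if c then r1 else r2) @^-1` A).
    by apply/seteqP; split=> x /= [].
  by rewrite P0E// muleC.
have mC0 : measurable (tauZ0 @^-1` C) by exact: mpre.
have -> : (fun x => (tau x, Z' x)) @^-1` C `&` zeta @^-1` A =
    q @^-1` ((tauZ0 @^-1` C) `*` A) by [].
rewrite qE; last exact: measurableX.
rewrite P1E// ge0_integral_pushforward//; last 2 first.
- exact: measurable_fun_pair.
- by apply: measurable_funTS; exact: measurable_kernel.
have mk := measurable_kernel (kernel_comap k mtauZ0) A mA.
transitivity (\int[pushforward P' (fst \o q)]_(x in tauZ0 @^-1` C)
    kernel_comap k mtauZ0 x A)%E.
  by apply: eq_measure_integral => B mB _; exact/esym/qE1.
by rewrite ge0_integral_pushforward//; exact: measurable_funTS.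
Qed.

(** * Choice of the lengths and of the compact set, and conclusion *)

Lemma joint_law_ae d (T : measurableType d) (R : realType)
    (P : probability T R) (tau Z : {RV P >-> R}) (r1 r2 : R)
    (p : R * R -> Prop) :
  (forall x, tau x = r1 \/ tau x = r2) ->
  {ae distribution P Z, forall z, p (r1, z)} ->
  {ae distribution P Z, forall z, p (r2, z)} ->
  {ae pushforward P (fun x => (tau x, Z x)), forall v, p v}.
Proof.
move=> tau12 [N1 [mN1 N10 pN1]] [N2 [mN2 N20 pN2]].
have mr : measurable (~` [set r1] `&` ~` [set r2]).
  by apply: measurableI; exact: measurableC.
(* The exceptional set is the region off the two slices, which [tau] never enters, together with a
   null set in each slice. *)
pose N := (~` [set r1] `&` ~` [set r2]) `*` [set: R] `|`
  (([set r1] `*` N1) `|` ([set r2] `*` N2)).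
have mN : measurable N by apply: measurableU; [|apply: measurableU]; exact: measurableX.
exists N; split => //.
  have mZ B : measurable B -> measurable (Z @^-1` B).
    by move=> mB; rewrite -[X in measurable X]setTI; exact: measurable_funPT.
  have ZN : P (Z @^-1` N1 `|` Z @^-1` N2) = 0%E.
    by rewrite measureU0 => //; exact: mZ.
  apply: (subset_measure0 _ _ _ ZN).
  - by rewrite -[X in measurable X]setTI; exact: measurable_fun_pair.
  - by apply: measurableU; exact: mZ.
  - move=> x [[[/= n1 n2] _]|[[_ ?]|[_ ?]]]; [|by left|by right].
    by case: (tau12 x).
move=> [r z] /= npz; have [r1E|r1E] := pselect (r = r1).
  by right; left; split=> //=; apply: pN1; rewrite -r1E.
have [r2E|r2E] := pselect (r = r2); last by left.
by right; right; split=> //=; apply: pN2; rewrite -r2E.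
Qed.

(** By integration over sections, [m]-almost every length is positive and admissible for almost
    every [z]. If all such lengths coincided, [m] would be concentrated at one point. *)
Lemma two_admissible_lengths (R : realType) (f : R -> R -> \bar R)
    (m mu : probability R R) :
  {ae m, forall r, 0 < r} -> ~ almost_surely_constant m id ->
  {ae (m \x mu)%E, forall rz, admissible f rz.1 rz.2} ->
  exists r1 r2, [/\ 0 < r1, r1 < r2, {ae mu, forall z, admissible f r1 z} &
    {ae mu, forall z, admissible f r2 z}].
Proof.
move=> m0 mnc [N [mN N0 aN]].
have ae_good : {ae m, forall r, 0 < r /\ {ae mu, forall z, admissible f r z}}.
  have mx : measurable_fun [set: R] (fun r => mu (xsection N r)).
    exact: measurable_fun_xsection.
  have : m ([set: R] `&` [set r | mu (xsection N r) != 0%E]) = 0%E.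
    by apply/ge0_integral_eq0P.
  rewrite setTI => M0.
  have mM : measurable [set r | mu (xsection N r) != 0%E].
    by rewrite -[X in measurable X]setTI; exact: emeasurable_neq.
  have negM : m.-negligible [set r | mu (xsection N r) != 0%E] by exact/negligibleP.
  apply: negligibleS (negligibleU m0 negM) => r /= bad.
  have [r0|r0] := pselect (0 < r); [right|by left].
  apply/eqP => Nr0; apply: bad; split => //; exists (xsection N r); split => //.
    exact: measurable_xsection.
  by move=> z /= nz; rewrite /xsection/= inE; exact: aN.
pose good r := 0 < r /\ {ae mu, forall z, admissible f r z}.
have exgood c : exists2 r, good r & r <> c.
  apply: contrapT => H; apply: mnc; exists c.
  apply: negligibleS ae_good => r /= rc gr; apply: H; by exists r.
(* The first use only provides some good length [r]; the second provides one different from [r]. *)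
have [r [r0 rg] _] := exgood 0; have [s [s0 sg] sr] := exgood r.
case: (ltgtP s r) => [lt|lt|//]; [by exists s, r|by exists r, s].
Qed.

(** Where the density of [muac] does not vanish, [muac]-null sets are Lebesgue-null. That set
    carries all of [muac], so it has positive Lebesgue measure and contains a suitable compact [K];
    as [mu] dominates [a] times [muac] with [a] nonzero, [mu]-null sets are [muac]-null. *)
Lemma lebesgue_decomposition_compact (R : realType) (mu : set R -> \bar R)
    (a : R) (mus muac : probability R R) :
  lebesgue_decomposition mu a mus muac -> a <> 0 ->
  exists K, [/\ compact K, (0 < lebesgue_measure K)%E &
    forall N, measurable N -> N `<=` K -> mu N = 0%E -> lebesgue_measure N = 0%E].
Proof.
move=> [/andP[a0 a1] muE muacL _] /eqP aN0.
pose idR : {mfun R >-> measurableTypeR R} := HB.pack (id : R -> measurableTypeR R)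
  (isMeasurableFun.Build _ _ R (measurableTypeR R) id (@measurable_id _ R setT)).
have muac_null N : measurable N -> lebesgue_measure N = 0%E -> muac N = 0%E.
  by move: muacL => /null_content_dominatesP H mN; exact: H.
have [|S [mS nS SN]] := @dominated_ae_equivalent _ _ _ lebesgue_measure
    (distribution muac idR).
  by apply/null_content_dominatesP => N mN; exact: muac_null.
have S0 : (0 < lebesgue_measure S)%E.
  rewrite lt0e measure_ge0 andbT; apply/eqP => /(muac_null _ mS) S0.
  have : muac setT = 0%E by rewrite -(setvU S) measureU0//; exact: measurableC.
  by rewrite probability_setT => /eqP; rewrite onee_eq0.
have [K [cK KS K0]] := inner_compact_gt0 mS S0.
exists K; split => // N mN NK muN; apply: SN => //; first exact: subset_trans KS.
have acge0 : (0 <= a%:E * muac N)%E by rewrite mule_ge0.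
have : (a%:E * muac N = 0)%E.
  apply/eqP; rewrite eq_le acge0 andbT -muN muE//.
  by rewrite leeDr// mule_ge0// lee_fin subr_ge0.
by move/eqP; rewrite mule_eq0 eqe (negbTE aN0) => /eqP.
Qed.

Theorem theorem2p8 (R : realType)
  (PX : probability (skorohod R) R) (f : R -> R -> \bar R)
  (hX : levy_law PX)
  (hf : marginal_density PX f)
  (* the bridge laws are well defined *)
  (hbridge : forall r z : R, 0 < r -> admissible f r z ->
     exists Q : probability (skorohod R) R, bridge_law PX f r z Q)
  (d : measure_display) (Omega : measurableType d) (P : probability Omega R)
  (hP : measure_is_complete P)
  (Z : {RV P >-> R})
  (* Z admits at least one non-degenerate length *)
  (hlen : exists m : probability R R,
     [/\ {ae m, forall r, 0 < r},
         ~ almost_surely_constant m id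
       & {ae (m \x distribution P Z)%E, forall rz, admissible f rz.1 rz.2}])
  (aac : R) (PZs PZac : probability R R)
  (hdec : lebesgue_decomposition (distribution P Z) aac PZs PZac)
  (haac : aac <> 0) :
  exists (d' : measure_display) (Omega' : measurableType d')
    (P' : probability Omega' R) (p : Omega' -> Omega)
    (tau Z' : {RV P' >-> R}),
    [/\ measure_is_complete P',
        space_extension P P' p,
        forall x, Z' x = Z (p x),
        ~ almost_surely_constant P' tau
      & (exists zeta : {RV P' >-> skorohod R}, levy_bridge PX f tau Z' zeta) /\
        (forall zeta : {RV P' >-> skorohod R}, levy_bridge PX f tau Z' zeta ->
           ~ markov_property P' (fun t x => zeta x t))].
Proof.
have [m [m0 mnc adm]] := hlen.
have [r1 [r2 [r10 r12 adm1 adm2]]] := two_admissible_lengths m0 mnc adm.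
have r20 := lt_trans r10 r12.
have [K [cK K0 KZ]] := lebesgue_decomposition_compact hdec haac.
have [k [k1 k2]] := two_lengths_kernel hf hbridge r10 r12.
have [d' [T' [P' [p [tau [Z' [zeta [cP' pP' Z'E [tau12 P1 P2] [ind rcd]]]]]]]]] :=
  two_lengths_space Z k r12.
have Z'P A : measurable A -> distribution P' Z' A = distribution P Z A.
  move=> mA; rewrite /distribution /pushforward.
  have -> : Z' @^-1` A = p @^-1` (Z @^-1` A).
    by apply/seteqP; split=> x /=; rewrite Z'E.
  by apply: pP'.2; rewrite -[X in measurable X]setTI; exact: measurable_funPT.
have ae_Z' (b : R -> Prop) :
    {ae distribution P Z, forall z, b z} -> {ae distribution P' Z', forall z, b z}.
  by move=> [N [mN N0 bN]]; exists N; split => //; rewrite -N0 -Z'P.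
exists d', T', P', p, tau, Z'; split => //.
  (* Whatever the constant [c], one of the two lengths differs from it, and the event of that length
     would be negligible. *)
  move=> [c]; have [cr|cr] := pselect (c = r1).
    move=> /(negligibleS (B := tau @^-1` [set r2])) H; move/eqP: P2; apply.
    apply/negligibleP.
      by rewrite -[X in measurable X]setTI; exact: measurable_funPT.
    by apply: H => x /= ->; rewrite cr; apply/eqP; rewrite gt_eqF.
  move=> /(negligibleS (B := tau @^-1` [set r1])) H; move/eqP: P1; apply.
  apply/negligibleP.
    by rewrite -[X in measurable X]setTI; exact: measurable_funPT.
  by apply: H => x /= -> /esym.
split.
  exists zeta; split => //.
  - by move=> x; case: (tau12 x) => ->.
  - apply: (joint_law_ae (p := fun v => admissible f v.1 v.2) tau12);
      exact: ae_Z'.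
  - exists k; split => //.
    apply: (joint_law_ae (p := fun v => bridge_law PX f v.1 v.2 (k v)) tau12).
    + apply: ae_Z'; apply: negligibleS adm1 => z /= nz az; apply: nz; exact: k1.
    + apply: ae_Z'; apply: negligibleS adm2 => z /= nz az; apply: nz; exact: k2.
(* The failure is proved for an arbitrary bridge with this [tau] and [Z'], not only for the
   constructed [zeta]. *)
move=> zeta' bz'; apply: (two_lengths_not_markov hX hf bz' r10 r12 P1 P2 tau12 cK K0).
by move=> N mN NK; rewrite Z'P//; exact: KZ.
Qed.
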